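(* For any integer $k\ge3$, any real $1\le p<k$, and $b\in\{0,1\}$, there exists a computable $(p,k,C_b,\varepsilon)$-isolating parallelepiped for some \[ \varepsilon\ \ge\ \frac{|\sin(\pi p/2)|}{p^2}\cdot\Big(\frac{2p}{e^2\pi^2k}\Big)^{(p+1)/2}. \] Up to scaling, this is achieved (in $\{-1,1\}$ coordinates) by the following parallelepiped: let $\eta:=\lfloor k/2\rfloor+\lfloor p/2\rfloor$, $\alpha_{\vec u}:=1+(-1)^{\eta+b}\prod_{i}u_i$ for $\vec u\in\{-1,1\}^k$, and $t^*:=(1+(-1)^{k+1})/2$; let $W\in\mathbb{R}^{2^k\times k}$ be the matrix whose row indexed by $\vec u$ is $\alpha_{\vec u}^{1/p}\vec u^T$ and $\vec w\in\mathbb{R}^{2^k}$ the vector with $w_{\vec u}=\alpha_{\vec u}^{1/p}t^*$; then $\|W\vec y-\vec w\|_p^p$, for $\vec y\in\{-1,1\}^k$, takes one value $a$ when $\vec y$ corresponds (via $\vec y=\vec 1-2\vec x$) to $\vec x\in C_b^{-1}(1)$ and another value $a(1+\varepsilon)^p$ when $\vec x\in C_b^{-1}(0)$.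
   Context: $\|\vec x\|_p=(\sum_i|x_i|^p)^{1/p}$. $C_1(x_1,\dots,x_k):=x_1\oplus\cdots\oplus x_k$ and $C_0:=\neg C_1$. For a constraint $C:\{0,1\}^k\to\{0,1\}$ and $\varepsilon\ge0$, $V\in\mathbb{R}^{d^*\times k}$ with full column rank and $\vec t^*\in\mathbb{R}^{d^*}$ define a $(p,k,C,\varepsilon)$-isolating parallelepiped if $\|V\vec x-\vec t^*\|_p=1$ for all $\vec x\in C^{-1}(1)$ and $\|V\vec x-\vec t^*\|_p=1+\varepsilon$ for all $\vec x\in C^{-1}(0)$. Passing from $\{-1,1\}$ coordinates to $\{0,1\}$ coordinates means using $V=-2W$, $\vec t^*=\vec w-W\vec 1$, so that $\|V\vec x-\vec t^*\|_p=\|W(\vec 1-2\vec x)-\vec w\|_p$, and then scaling. *)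

(* Defs.v *)
From HB Require Import structures.
From mathcomp Require Import all_boot all_order all_algebra.
From mathcomp Require Import all_classical all_reals all_analysis.

Set Implicit Arguments.
Unset Strict Implicit.
Unset Printing Implicit Defensive.

Import Order.TTheory GRing.Theory Num.Theory.
Import numFieldNormedType.Exports.

Local Open Scope ring_scope.

Definition lpnorm (R : realType) (p : R) (d : nat) (x : 'cV[R]_d) : R :=
  (\sum_(i < d) `|x i 0| `^ p) `^ (p^-1).

(* Points of {0,1}^k and of {-1,1}^k are both represented by Boolean vectors;
   [bit_col] reads x as a 0/1 vector, and [sign_col] applies y = 1 - 2x. *)
Notation boolvec k := {ffun 'I_k -> bool}.

Definition bit_col (R : realType) (k : nat) (x : boolvec k) : 'cV[R]_k :=
  \col_i (x i)%:R.

Definition sign_col (R : realType) (k : nat) (x : boolvec k) : 'cV[R]_k :=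
  const_mx 1 - 2 *: bit_col R x.

Definition parity_constraint (b : bool) (k : nat) (x : boolvec k) : bool :=
  if b then \big[addb/false]_(i < k) x i
  else ~~ \big[addb/false]_(i < k) x i.

Definition isolating_parallelepiped (R : realType) (p : R) (k : nat)
    (C : boolvec k -> bool) (eps : R) (d : nat)
    (V : 'M[R]_(d, k)) (t : 'cV[R]_d) : Prop :=
  [/\ 0 <= eps,
      \rank V = k,
      forall x, C x = true -> lpnorm p (V *m bit_col R x - t) = 1
    & forall x, C x = false -> lpnorm p (V *m bit_col R x - t) = 1 + eps].

(* Total functions nat^n -> nat that are (general) recursive in the oracle phi:
   Kleene's closure of the initial functions and phi under composition,
   primitive recursion, and minimization of regular functions. *)
Inductive recursive_in (phi : nat -> nat) :
    forall n : nat, (n.-tuple nat -> nat) -> Prop :=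
| rec_oracle : recursive_in phi (fun x : 1.-tuple nat => phi (tnth x ord0))
| rec_zero : recursive_in phi (fun _ : 0.-tuple nat => 0%N)
| rec_succ : recursive_in phi (fun x : 1.-tuple nat => (tnth x ord0).+1)
| rec_proj (n : nat) (i : 'I_n) :
    recursive_in phi (fun x : n.-tuple nat => tnth x i)
| rec_comp (m n : nat) (g : m.-tuple nat -> nat)
    (h : 'I_m -> n.-tuple nat -> nat) :
    recursive_in phi g -> (forall i, recursive_in phi (h i)) ->
    recursive_in phi (fun x => g [tuple h i x | i < m])
| rec_prim (n : nat) (g : n.-tuple nat -> nat) (h : n.+2.-tuple nat -> nat)
    (f : n.+1.-tuple nat -> nat) :
    recursive_in phi g -> recursive_in phi h ->
    (forall x : n.-tuple nat, f [tuple of 0%N :: x] = g x) ->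
    (forall (y : nat) (x : n.-tuple nat), f [tuple of y.+1 :: x] =
                 h [tuple of y :: f [tuple of y :: x] :: x]) ->
    recursive_in phi f
| rec_mu (n : nat) (g : n.+1.-tuple nat -> nat) (f : n.-tuple nat -> nat) :
    recursive_in phi g ->
    (forall x, g [tuple of f x :: x] = 0%N) ->
    (forall (x : n.-tuple nat) (y : nat), (y < f x)%N -> g [tuple of y :: x] <> 0%N) ->
    recursive_in phi f.

(* phi is a name of the nonnegative real p: phi n / 2^n is within 2^-n of p. *)
Definition dyadic_name (R : realType) (p : R) (phi : nat -> nat) : Prop :=
  forall n : nat, `|2 ^+ n * p - (phi n)%:R| <= 1.

(* x is a computable real relative to p: from any name of p one can compute
   dyadic approximations (f n - g n) / 2^n of x with error at most 2^-n. *)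
Definition computable_from (R : realType) (p x : R) : Prop :=
  forall phi : nat -> nat, dyadic_name p phi ->
  exists f g : 1.-tuple nat -> nat,
    [/\ recursive_in phi f, recursive_in phi g
      & forall n : nat,
          `|2 ^+ n * x - ((f [tuple n])%:R - (g [tuple n])%:R)| <= 1].

Definition computable_parallelepiped (R : realType) (p : R) (k d : nat)
    (V : 'M[R]_(d, k)) (t : 'cV[R]_d) : Prop :=
  (forall i j, computable_from p (V i j)) /\
  (forall i, computable_from p (t i 0)).

(* The rows are indexed by u in {-1,1}^k, through an enumeration of boolvec k. *)
Definition nsigns (k : nat) : nat := #|{: boolvec k}|.

Lemma nsignsE (k : nat) : nsigns k = (2 ^ k)%N.
Proof. by rewrite /nsigns card_ffun card_bool card_ord. Qed.

Definition row_sign (R : realType) (k : nat) (i : 'I_(nsigns k)) : 'cV[R]_k :=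
  sign_col R (enum_val i).

Definition eta_exp (R : realType) (p : R) (k : nat) : int :=
  (k %/ 2)%N%:Z + Num.floor (p / 2).

Definition alpha (R : realType) (p : R) (k : nat) (b : bool)
    (u : 'cV[R]_k) : R :=
  1 + (-1) ^ (eta_exp p k + (b : nat)%:Z) * \prod_(i < k) u i 0.

Definition tstar (R : realType) (k : nat) : R := (1 + (-1) ^+ k.+1) / 2.

Definition Wmx (R : realType) (p : R) (k : nat) (b : bool) :
    'M[R]_(nsigns k, k) :=
  \matrix_(i, j) (alpha p b (row_sign R i) `^ (p^-1) * row_sign R i j 0).

Definition wvec (R : realType) (p : R) (k : nat) (b : bool) :
    'cV[R]_(nsigns k) :=
  \col_i (alpha p b (row_sign R i) `^ (p^-1) * tstar R k).

(* Main.v *)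
(* Substituting u -> u y turns |W y - w|_p^p into A + s B, where A and B are the
   plain and the parity-twisted p-th moments of (sum of k signs) - t, and the
   sign s only depends on the parity of y. So everything rests on the sign of B
   and on a lower bound for |B| / A.

   Counting signs, B is a multiple of T = sum_(1 <= i <= M) (-1)^i C(2M, M+i) i^p
   with M = ceil(k/2), which up to a factorial is the divided difference of
   x^(p/2 - 1) at the nodes 1, 4, ..., M^2. Write p = 2n + q with 0 <= q < 2.
   For q = 0 it vanishes. For q > 0, the partial fraction expansion of
   y^(2n) / prod (y^2 + j^2), multiplied by y^(q-1) and integrated over y > 0, gives
     (-1)^(n+1) T = (2M)!/2 * J / I,
     J = int y^(p-1) / prod (y^2 + j^2) dy,  I = int y^(q-1) / (1 + y^2) dy,
   since each summand rescales to I. Here I <= 2 / (q (2 - q)) produces the factor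
   |sin (pi p / 2)|, and prod (1 + y^2/j^2) <= exp (pi y) bounds J from below.
   The moment A is at most 2^(k+1) (2 M p / e)^(p/2), by exponential moments.

   The entries are integer multiples of (N / a)^(1/p), where a is a sum of terms
   m^p with integers m, N, and rational powers of rationals are approximated by
   integer roots, which minimization finds. *)

Require Import Defs.
From HB Require Import structures.
From mathcomp Require Import all_boot all_order all_algebra.
From mathcomp Require Import all_classical all_reals all_analysis.

From mathcomp Require Import zify ring lra.

Set Implicit Arguments.
Unset Strict Implicit.
Unset Printing Implicit Defensive.

Import Order.TTheory GRing.Theory Num.Theory.
Import numFieldNormedType.Exports.

Local Open Scope ring_scope.

(** * Recursive functions and computable reals *)

Section RecursiveFunctions.
Variable phi : nat -> nat.
Local Notation rec f := (recursive_in phi f).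

Lemma recursive_ext (n : nat) (f g : n.-tuple nat -> nat) :
  f =1 g -> rec f -> rec g.
Proof. by move=> /funext ->. Qed.

Lemma recursive_comp1 (n : nat) (g : nat -> nat) (f : n.-tuple nat -> nat) :
  rec (fun x : 1.-tuple nat => g (tnth x ord0)) -> rec f ->
  rec (fun x => g (f x)).
Proof.
move=> rg rf; have := @rec_comp phi 1 n _ (fun=> f) rg (fun=> rf).
by apply: recursive_ext => x; rewrite tnth_mktuple.
Qed.

Lemma recursive_comp2 (n : nat) (g : nat -> nat -> nat)
    (f1 f2 : n.-tuple nat -> nat) :
  rec (fun x : 2.-tuple nat => g (tnth x ord0) (tnth x ord_max)) ->
  rec f1 -> rec f2 -> rec (fun x => g (f1 x) (f2 x)).
Proof.
move=> rg r1 r2.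
have rh (i : 'I_2) : rec (if i == ord0 then f1 else f2) by case: ifP.
have := rec_comp rg rh.
by apply: recursive_ext => x; rewrite !tnth_mktuple.
Qed.

Lemma recursive_succ (n : nat) (f : n.-tuple nat -> nat) :
  rec f -> rec (fun x => (f x).+1).
Proof. by move=> rf; exact: (recursive_comp1 (rec_succ phi) rf). Qed.

Lemma recursive_const (n c : nat) : rec (fun _ : n.-tuple nat => c).
Proof.
elim: c => [|c IH]; last exact: recursive_succ.
have h (i : 'I_0) : rec (fun _ : n.-tuple nat => 0%N) by case: i.
exact: (rec_comp (rec_zero phi) h).
Qed.

(** Primitive recursion runs on the head of the tuple, so exponentiation and subtraction, which
    recurse on their second argument, enter with their arguments swapped. *)
Lemma recursive_prim2 (f : nat -> nat -> nat) (g : nat -> nat)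
    (h : nat -> nat -> nat -> nat) :
  rec (fun x : 1.-tuple nat => g (tnth x ord0)) ->
  rec (fun x : 3.-tuple nat =>
         h (tnth x ord0) (tnth x (inord 1)) (tnth x ord_max)) ->
  (forall z, f 0%N z = g z) -> (forall y z, f y.+1 z = h y (f y z) z) ->
  rec (fun x : 2.-tuple nat => f (tnth x ord0) (tnth x ord_max)).
Proof.
move=> rg rh f0 fS; apply: (rec_prim rg rh) => [x|y x].
  by rewrite -f0 !(tnth_nth 0%N).
by rewrite !(tnth_nth 0%N) /= inordK //= fS.
Qed.

Lemma recursive_add (n : nat) (f g : n.-tuple nat -> nat) :
  rec f -> rec g -> rec (fun x => f x + g x)%N.
Proof.
apply: recursive_comp2.
apply: (@recursive_prim2 addn id (fun _ r _ => r.+1)) => //.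
- exact: rec_proj.
- by apply: recursive_succ; exact: rec_proj.
Qed.

Lemma recursive_mul (n : nat) (f g : n.-tuple nat -> nat) :
  rec f -> rec g -> rec (fun x => f x * g x)%N.
Proof.
apply: recursive_comp2.
apply: (@recursive_prim2 muln (fun=> 0%N) (fun _ r z => z + r)%N) => //.
- exact: recursive_const.
- by apply: recursive_add; exact: rec_proj.
Qed.

Lemma recursive_exp (n : nat) (f g : n.-tuple nat -> nat) :
  rec f -> rec g -> rec (fun x => f x ^ g x)%N.
Proof.
move=> rf rg; apply: (@recursive_comp2 _ (fun a b => b ^ a)%N g f) => //.
apply: (@recursive_prim2 (fun a b => b ^ a)%N (fun=> 1%N)
                         (fun _ r z => z * r)%N) => //.
- exact: recursive_const.
- by apply: recursive_mul; exact: rec_proj.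
- by move=> y z; rewrite expnS.
Qed.

Lemma recursive_pred (n : nat) (f : n.-tuple nat -> nat) :
  rec f -> rec (fun x => (f x).-1).
Proof.
move=> rf; apply: (@recursive_comp2 _ (fun a b => a.-1) f f) => //.
apply: (@recursive_prim2 (fun a b => a.-1) (fun=> 0%N) (fun y _ _ => y)) => //.
- exact: recursive_const.
- exact: rec_proj.
Qed.

Lemma recursive_sub (n : nat) (f g : n.-tuple nat -> nat) :
  rec f -> rec g -> rec (fun x => f x - g x)%N.
Proof.
move=> rf rg; apply: (@recursive_comp2 _ (fun a b => b - a)%N g f) => //.
apply: (@recursive_prim2 (fun a b => b - a)%N id (fun _ r _ => r.-1)) => //.
- exact: rec_proj.
- by apply: recursive_pred; exact: rec_proj.
- by move=> z; rewrite subn0.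
- by move=> y z; rewrite subnS.
Qed.

Lemma recursive_shift (n : nat) (f : n.-tuple nat -> nat) :
  rec f -> rec (fun x : n.+1.-tuple nat => f [tuple of behead x]).
Proof.
move=> rf.
have rh (i : 'I_n) : rec (fun x : n.+1.-tuple nat => tnth x (lift ord0 i)).
  exact: rec_proj.
have := rec_comp rf rh; apply: recursive_ext => x; congr f.
apply: eq_from_tnth => i; rewrite tnth_mktuple tnth_behead; congr tnth.
by apply: val_inj; rewrite /= inordK // ltnS.
Qed.

(** [r] is the integer part of the [d]-th root of [a / b], that is, the least [y] with
    [a < (y + 1)^d b]; minimization finds it as the first zero of the truncated difference
    [a + 1 - (y + 1)^d b]. With [d = 1] this is Euclidean division. *)
Lemma recursive_root (n : nat) (a b d r : n.-tuple nat -> nat) :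
  rec a -> rec b -> rec d ->
  (forall x, (r x ^ d x * b x <= a x)%N) ->
  (forall x, (a x < (r x).+1 ^ d x * b x)%N) -> rec r.
Proof.
move=> ra rb rd r1 r2.
have rg : rec (fun x : n.+1.-tuple nat =>
    (a [tuple of behead x]).+1
     - (tnth x ord0).+1 ^ d [tuple of behead x] * b [tuple of behead x])%N.
  apply: recursive_sub; first by apply: recursive_succ; exact: recursive_shift.
  apply: recursive_mul; last exact: recursive_shift.
  apply: recursive_exp; last exact: recursive_shift.
  by apply: recursive_succ; exact: rec_proj.
have beheadE y (x : n.-tuple nat) : [tuple of behead [tuple of y :: x]] = x.
  exact: val_inj.
apply: (rec_mu rg) => [x|x y yr]; rewrite beheadE (tnth_nth 0%N) /=.
  by apply/eqP; rewrite subn_eq0.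
apply/eqP; rewrite subn_eq0 -ltnNge ltnS; apply: leq_trans (r1 x).
by rewrite leq_mul2r; apply/orP; right; case: (d x) => // e; rewrite leq_exp2r.
Qed.

End RecursiveFunctions.

(** * Reals approximated by quotients of recursive functions *)

Section ApproximableReals.
Variables (R : realType) (phi : nat -> nat).
Local Notation rec1 f :=
  (recursive_in phi (fun x : 1.-tuple nat => f (tnth x ord0))).

(* C need not be computable: it only costs a shift of n. *)
Definition approximable (x : R) : Prop :=
  exists (N D : nat -> nat) (C : R),
    [/\ rec1 N, rec1 D, forall n, (0 < D n)%N
      & forall n, `|x - (N n)%:R / (D n)%:R| <= C / 2 ^+ n].

Lemma exists_exp2_ge (C : R) : exists s : nat, C <= 2 ^+ s.
Proof.
have [C0|C0] := leP C 0; first by exists 0%N; rewrite expr0 (le_trans C0).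
exists (Num.bound C); apply: ltW; apply: lt_le_trans (archi_boundP (ltW C0)) _.
by rewrite -natrX ler_nat ltnW // ltn_expl.
Qed.

(** The approximations may be good only from some rank on, itself merely known to exist: shifting
    the index by a constant preserves recursiveness, and the error bound only decreases. *)
Lemma approximable_shift (x : R) (N D : nat -> nat) (C : R) (n0 : nat) :
  rec1 N -> rec1 D -> (forall n, (n0 <= n)%N -> (0 < D n)%N) ->
  (forall n, (n0 <= n)%N -> `|x - (N n)%:R / (D n)%:R| <= C / 2 ^+ n) ->
  approximable x.
Proof.
move=> rN rD D0 h.
have rs : rec1 (fun n => n + n0)%N.
  by apply: recursive_add; [exact: rec_proj|exact: recursive_const].
exists (fun n => N (n + n0)%N), (fun n => D (n + n0)%N), C; split.
- exact: (recursive_comp1 rN rs).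
- exact: (recursive_comp1 rD rs).
- by move=> n; rewrite D0 // leq_addl.
- move=> n; apply: le_trans (h _ (leq_addl _ _)) _.
  have C0 : 0 <= C.
    have := le_trans (normr_ge0 _) (h _ (leqnn n0)).
    by rewrite pmulr_lge0 // invr_gt0 exprn_gt0.
  rewrite ler_wpM2l // lef_pV2 ?posrE ?exprn_gt0 //.
  by rewrite ler_weXn2l ?ler1n // leq_addr.
Qed.

Lemma approximable_nat (c : nat) : approximable c%:R.
Proof.
exists (fun=> c), (fun=> 1%N), 0; split => //; try exact: recursive_const.
by move=> n; rewrite mul0r divr1 subrr normr0.
Qed.

Lemma approximable_name (p : R) : dyadic_name p phi -> approximable p.
Proof.
move=> hp; exists phi, (fun n => 2 ^ n)%N, 1; split.
- exact: rec_oracle.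
- by apply: recursive_exp; [exact: recursive_const|exact: rec_proj].
- by move=> n; rewrite expn_gt0.
- move=> n; rewrite natrX div1r -[leRHS]mul1r ler_pdivlMr ?exprn_gt0 //.
  rewrite -[X in _ * X](@gtr0_norm _ (2 ^+ n)) ?exprn_gt0 // -normrM mulrBl.
  by rewrite divfK ?expf_neq0 // mulrC hp.
Qed.

Lemma approximable_add (x y : R) :
  approximable x -> approximable y -> approximable (x + y).
Proof.
move=> [N [D [C [rN rD D0 h]]]] [N' [D' [C' [rN' rD' D0' h']]]].
exists (fun n => N n * D' n + N' n * D n)%N, (fun n => D n * D' n)%N, (C + C').
split.
- by apply: recursive_add; apply: recursive_mul.
- exact: recursive_mul.
- by move=> n; rewrite muln_gt0 D0 D0'.
- move=> n; have Dn : (D n)%:R != 0 :> R by rewrite pnatr_eq0 -lt0n.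
  have Dn' : (D' n)%:R != 0 :> R by rewrite pnatr_eq0 -lt0n.
  rewrite natrD !natrM.
  have -> : x + y - ((N n)%:R * (D' n)%:R + (N' n)%:R * (D n)%:R) / ((D n)%:R * (D' n)%:R)
     = (x - (N n)%:R / (D n)%:R) + (y - (N' n)%:R / (D' n)%:R).
    by field; rewrite Dn Dn'.
  by rewrite mulrDl; apply: le_trans (ler_normD _ _) _; rewrite lerD.
Qed.

Lemma approximable_natM (c : nat) (x : R) :
  approximable x -> approximable (c%:R * x).
Proof.
move=> [N [D [C [rN rD D0 h]]]].
exists (fun n => c * N n)%N, D, (c%:R * C); split => //.
- by apply: recursive_mul => //; exact: recursive_const.
- move=> n; rewrite natrM -!mulrA -mulrBr normrM normr_nat.
  by rewrite ler_wpM2l.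
Qed.

Lemma approximable_sum (I : finType) (F : I -> R) :
  (forall i, approximable (F i)) -> approximable (\sum_i F i).
Proof.
move=> hF; apply: big_ind => //; first exact: (approximable_nat 0).
by move=> x y; exact: approximable_add.
Qed.

(** Once the error is at most [x / 2], the approximating fraction is at least [x / 2]; it can then
    be inverted, which multiplies the error by at most [2 / x^2]. *)
Lemma approximable_inv (x : R) : 0 < x -> approximable x -> approximable x^-1.
Proof.
move=> x0 [N [D [C [rN rD D0 h]]]].
have [n0 hn0] := exists_exp2_ge (2 * C / x).
have close n : (n0 <= n)%N -> x / 2 <= (N n)%:R / (D n)%:R.
  move=> le_n; have C2 : C / 2 ^+ n <= x / 2.
    rewrite ler_pdivrMr ?exprn_gt0 //.
    have : 2 * C / x <= 2 ^+ n.
      by apply: le_trans hn0 _; rewrite ler_weXn2l ?ler1n.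
    rewrite ler_pdivrMr //; lra.
  by have := le_trans (h n) C2; rewrite ler_norml; lra.
have N0 n : (n0 <= n)%N -> (0 < N n)%N.
  move=> /close; case: (N n) => // cl; move: cl; rewrite mul0r; lra.
apply: (@approximable_shift _ D N (C * 2 / x ^+ 2) n0) => // n le_n.
have Dn : (0 : R) < (D n)%:R by rewrite ltr0n.
have Nn : (0 : R) < (N n)%:R by rewrite ltr0n N0.
have := close n le_n; have := h n.
rewrite -(invf_div (N n)%:R); set r := _ / _ => hr cr.
have r0 : 0 < r by rewrite divr_gt0.
have -> : x^-1 - r^-1 = (r - x) * (x^-1 * r^-1).
  by field; rewrite !gt_eqF.
rewrite normrM distrC.
have -> : C * 2 / x ^+ 2 / 2 ^+ n = C / 2 ^+ n * (2 / x ^+ 2).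
  by rewrite -!mulrA; congr (_ * _); rewrite mulrA mulrC.
apply: ler_pM => //; rewrite gtr0_norm ?mulr_gt0 ?invr_gt0 //.
rewrite expr2 [(x * x)^-1]invfM mulrCA ler_pM2l ?invr_gt0 //.
by rewrite -[leRHS]invf_div lef_pV2 ?posrE ?divr_gt0.
Qed.

Lemma norm_expRB_le (a b : R) :
  `|expR a - expR b| <= expR (Num.max a b) * `|a - b|.
Proof.
wlog ab : a b / b <= a.
  by case/orP: (le_total b a) => [ba|ab] W; [|rewrite distrC maxC (distrC a)]; apply: W.
rewrite max_l // !ger0_norm ?subr_ge0 ?ler_expR //.
have := expR_ge1Dx (b - a); rewrite expRB => h.
have : expR a * (1 + (b - a)) <= expR a * (expR b / expR a).
  by rewrite ler_pM2l ?expR_gt0.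
rewrite mulrCA divff ?expR_eq0 // mulr1; lra.
Qed.

Lemma ln_le_sub1 (x : R) : 0 < x -> ln x <= x - 1.
Proof. by move=> x0; have := @le_ln1Dx _ (x - 1); rewrite subrKC; apply; lra. Qed.

(** [x^q] is the exponential of [q ln x], and [K d] bounds the change of [q ln x]: [2 / x] is a
    Lipschitz constant of [ln] above [x / 2], and [|q| + 1] bounds [|q'|]. *)
Lemma powR_lipschitz (x q : R) : 0 < x ->
  exists2 L : R, 0 <= L & forall x' q' d : R, d <= x / 2 -> d <= 1 ->
    `|x - x'| <= d -> `|q - q'| <= d -> `|x `^ q - x' `^ q'| <= L * d.
Proof.
move=> x0; set K := `|ln x| + (`|q| + 1) * (2 / x).
have K0 : 0 <= K.
  by rewrite addr_ge0 // mulr_ge0 ?addr_ge0 // divr_ge0 // ltW.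
exists (expR (`|q * ln x| + K) * K) => [|x' q' d dx d1 hx hq].
  by rewrite mulr_ge0 ?expR_ge0.
have d0 : 0 <= d by exact: le_trans (normr_ge0 _) hx.
have x'x : x / 2 <= x' by move: hx; rewrite ler_norml; lra.
have x'0 : 0 < x' by lra.
have hq' : `|q'| <= `|q| + 1.
  have -> : q' = q - (q - q') by ring.
  by apply: le_trans (ler_normB _ _) _; rewrite lerD2l; lra.
have hln : `|ln x - ln x'| <= (2 / x) * d.
  have xx2 : x^-1 * d <= 2 / x * d.
    by rewrite ler_wpM2r // ler_peMl ?invr_ge0 ?ler1n // ltW.
  have x'x2 : x'^-1 <= 2 / x.
    by rewrite -[leRHS]invf_div lef_pV2 ?posrE ?divr_gt0.
  move: hx; rewrite !ler_norml => /andP[h1 h2]; apply/andP; split.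
    have := ln_le_sub1 (divr_gt0 x'0 x0); rewrite ln_div ?posrE //.
    have -> : x' / x - 1 = x^-1 * (x' - x) by field; rewrite gt_eqF.
    have : x^-1 * (x' - x) <= x^-1 * d by apply: ler_wpM2l; [rewrite invr_ge0 ltW|lra].
    lra.
  have := ln_le_sub1 (divr_gt0 x0 x'0); rewrite ln_div ?posrE //.
  have -> : x / x' - 1 = x'^-1 * (x - x') by field; rewrite gt_eqF.
  have : x'^-1 * (x - x') <= x'^-1 * d by rewrite ler_wpM2l ?invr_ge0 ?(ltW x'0).
  have : x'^-1 * d <= 2 / x * d by rewrite ler_wpM2r.
  lra.
have hab : `|q * ln x - q' * ln x'| <= K * d.
  have -> : q * ln x - q' * ln x' = (q - q') * ln x + q' * (ln x - ln x') by ring.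
  apply: le_trans (ler_normD _ _) _; rewrite !normrM /K mulrDl lerD //.
    by rewrite mulrC ler_wpM2l.
  by rewrite -mulrA; apply: ler_pM.
rewrite /powR !gt_eqF //.
apply: le_trans (norm_expRB_le _ _) _.
rewrite -mulrA; apply: ler_pM => //.
have Kd : K * d <= K by rewrite ler_piMr.
rewrite ler_expR ge_max; apply/andP; split.
  by apply: le_trans (ler_norm _) _; rewrite lerDl.
have := ler_norm (q * ln x); move: hab; rewrite ler_norml; lra.
Qed.

(** The power of the rational approximations, scaled by [2^n], becomes rational when raised to the
    power [D'], so its integer part is an integer root. The error has a Lipschitz part from the
    replacement and a part [2^-n] from the truncation. *)
Lemma approximable_powR (x q : R) :
  0 < x -> approximable x -> approximable q -> approximable (x `^ q).
Proof.
move=> x0 [N [D [C [rN rD D0 h]]]] [N' [D' [C' [rN' rD' D0' h']]]].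
have [L L0 hL] := powR_lipschitz q x0.
set E := Num.max C C'.
(* From rank [n0] on, the common error [E / 2^n] is at most [x / 2] and at most 1, as [hL]
   requires. *)
have [n0 hn0] := exists_exp2_ge (Num.max (E * (2 / x)) E).
pose v n : R := 2 ^+ n * ((N n)%:R / (D n)%:R) `^ ((N' n)%:R / (D' n)%:R).
have v0 n : 0 <= v n by rewrite mulr_ge0 ?exprn_ge0 ?powR_ge0.
have vX n : v n ^+ D' n * (D n ^ N' n)%:R = ((2 ^ n) ^ D' n * N n ^ N' n)%:R.
  have Dn : (D n)%:R != 0 :> R by rewrite pnatr_eq0 -lt0n.
  have Dn' : (D' n)%:R != 0 :> R by rewrite pnatr_eq0 -lt0n.
  have -> : v n ^+ D' n = 2 ^+ n ^+ D' n * ((N n)%:R / (D n)%:R) ^+ N' n.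
    rewrite /v exprMn -[X in _ * X = _]powR_mulrn ?powR_ge0 // -powRrM divfK //.
    by rewrite powR_mulrn ?divr_ge0.
  by rewrite expr_div_n natrM !natrX -mulrA divfK // expf_neq0.
pose r n : nat := Num.truncn (v n).
have rP n : (r n)%:R <= v n < (r n).+1%:R by exact: truncn_itv.
have rr : rec1 r.
  apply: (@recursive_root phi 1 (fun x => (2 ^ (tnth x ord0)) ^ D' (tnth x ord0)
     * N (tnth x ord0) ^ N' (tnth x ord0))%N
     (fun x => D (tnth x ord0) ^ N' (tnth x ord0))%N (fun x => D' (tnth x ord0))).
  - apply: recursive_mul; apply: recursive_exp => //.
    by apply: recursive_exp; [exact: recursive_const|exact: rec_proj].
  - exact: recursive_exp.
  - by [].
  - move=> y; set n := tnth y ord0.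
    rewrite -(ler_nat R) -vX natrM natrX ler_wpM2r // lerXn2r ?nnegrE //.
    by case/andP: (rP n).
  - move=> y; set n := tnth y ord0.
    rewrite -(ltr_nat R) -vX natrM ltr_pM2r ?ltr0n ?expn_gt0 ?D0 //.
    by rewrite natrX ltr_pXn2r ?nnegrE //; case/andP: (rP n).
apply: (@approximable_shift _ r (fun n => 2 ^ n)%N (L * E + 1) n0) => //.
- by apply: recursive_exp; [exact: recursive_const|exact: rec_proj].
- by move=> n _; rewrite expn_gt0.
move=> n le_n; pose X : R := (N n)%:R / (D n)%:R; pose Q : R := (N' n)%:R / (D' n)%:R.
have p2 : (0 : R) < 2 ^+ n by rewrite exprn_gt0.
have : Num.max (E * (2 / x)) E <= 2 ^+ n.
  by apply: le_trans hn0 _; rewrite ler_weXn2l ?ler1n.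
rewrite ge_max => /andP[E1 E2].
have hX : `|x - X| <= E / 2 ^+ n.
  by apply: le_trans (h n) _; rewrite ler_pM2r ?invr_gt0 // le_max lexx.
have hQ : `|q - Q| <= E / 2 ^+ n.
  by apply: le_trans (h' n) _; rewrite ler_pM2r ?invr_gt0 // le_max lexx orbT.
have e1 : E / 2 ^+ n <= x / 2.
  by rewrite ler_pdivrMr // mulrC -ler_pdivrMr ?divr_gt0 // invf_div.
have e2 : E / 2 ^+ n <= 1 by rewrite ler_pdivrMr // mul1r.
have := hL X Q _ e1 e2 hX hQ; set P := X `^ Q => hP.
have -> : x `^ q - (r n)%:R / (2 ^ n)%:R = (x `^ q - P) + (P - (r n)%:R / 2 ^+ n).
  by rewrite natrX; ring.
apply: le_trans (ler_normD _ _) _; rewrite mulrDl -mulrA lerD //.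
have /andP[r1 r2] := rP n.
have -> : P - (r n)%:R / 2 ^+ n = (v n - (r n)%:R) / 2 ^+ n.
  by rewrite /v -/X -/Q -/P mulrBl mulrAC divff ?gt_eqF ?mul1r.
rewrite normrM [X in _ * X]gtr0_norm ?invr_gt0 // ler_pM2r ?invr_gt0 //.
rewrite ger0_norm ?subr_ge0 //; move: r2; rewrite -natr1; lra.
Qed.

End ApproximableReals.

(** The allowed error 1 is split: the shift by [s] with [2 C <= 2^s] keeps the approximation error
    within 1/2, and rounding to a nearest integer costs another 1/2. The sign of [z] decides which
    of the two functions carries the result. *)
Lemma computable_from_intM (R : realType) (p x : R) (z : int) :
  (forall phi, dyadic_name p phi -> approximable phi x) ->
  computable_from p (z%:~R * x).
Proof.
move=> hx phi hphi.
have [N [D [C [rN rD D0 h]]]] := approximable_natM `|z|%N (hx phi hphi).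
have [s hs] := exists_exp2_ge (2 * C).
have rs : recursive_in phi (fun y : 1.-tuple nat => tnth y ord0 + s)%N.
  by apply: recursive_add; [exact: rec_proj|exact: recursive_const].
(* [num n / den n] is [2^n N / D + 1 / 2], with [N / D] taken at [n + s], so that the integer part
   rounds [2^n N / D]. *)
pose num n := (2 ^ n.+1 * N (n + s) + D (n + s))%N.
pose den n := (2 * D (n + s))%N.
have rden : recursive_in phi (fun y : 1.-tuple nat => den (tnth y ord0)).
  apply: recursive_mul; first exact: recursive_const.
  exact: (recursive_comp1 rD rs).
have rnum : recursive_in phi (fun y : 1.-tuple nat => num (tnth y ord0)).
  apply: recursive_add; last exact: (recursive_comp1 rD rs).
  apply: recursive_mul; last exact: (recursive_comp1 rN rs).
  apply: recursive_exp; first exact: recursive_const.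
  by apply: recursive_succ; exact: rec_proj.
have den0 n : (0 < den n)%N by rewrite muln_gt0 D0.
pose f (y : 1.-tuple nat) := (num (tnth y ord0) %/ den (tnth y ord0))%N.
have rf : recursive_in phi f.
  apply: (recursive_root rnum rden (recursive_const phi 1 1)) => y.
    by rewrite expn1 leq_trunc_div.
  by rewrite expn1 ltn_ceil.
have hf n : `|2 ^+ n * (`|z|%N%:R * x) - (f [tuple n])%:R| <= 1.
  rewrite /f (tnth_nth 0%N) /=; set r := (_ %/ _)%N.
  have r1 : (r * den n <= num n)%N by rewrite leq_trunc_div.
  have r2 : (num n < r.+1 * den n)%N by rewrite ltn_ceil.
  have dn : (0 : R) < (D (n + s)%N)%:R by rewrite ltr0n.
  set A := (N (n + s)%N)%:R / (D (n + s)%N)%:R : R.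
  have p2 : (0 : R) < 2 ^+ n by rewrite exprn_gt0.
  have hA : `|2 ^+ n * (`|z|%N%:R * x) - 2 ^+ n * A| <= 1 / 2.
    rewrite -mulrBr normrM gtr0_norm //.
    apply: le_trans (_ : 2 ^+ n * (C / 2 ^+ (n + s)) <= _).
      by rewrite ler_pM2l //; exact: h.
    have -> : 2 ^+ n * (C / 2 ^+ (n + s)) = C / 2 ^+ s.
      by rewrite exprD; field; rewrite !gt_eqF ?exprn_gt0.
    rewrite ler_pdivrMr ?exprn_gt0 //; lra.
  have h1 : r%:R <= 2 ^+ n * A + 1 / 2.
    have : (r * den n)%:R <= (num n)%:R :> R by rewrite ler_nat.
    rewrite /num /den natrD !natrM natrX exprS.
    have -> : 2 * 2 ^+ n * (N (n + s)%N)%:R + (D (n + s)%N)%:R =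
              (2 ^+ n * A + 1 / 2) * (2 * (D (n + s)%N)%:R) :> R.
      by rewrite /A; field; rewrite gt_eqF.
    by rewrite ler_pM2r // mulr_gt0.
  have h2 : 2 ^+ n * A + 1 / 2 < r%:R + 1.
    have : (num n)%:R < (r.+1 * den n)%:R :> R by rewrite ltr_nat.
    rewrite /num /den natrD !natrM natrX exprS natr1.
    have -> : 2 * 2 ^+ n * (N (n + s)%N)%:R + (D (n + s)%N)%:R =
              (2 ^+ n * A + 1 / 2) * (2 * (D (n + s)%N)%:R) :> R.
      by rewrite /A; field; rewrite gt_eqF.
    by rewrite ltr_pM2r // mulr_gt0.
  by move: hA; rewrite !ler_norml; lra.
have r0 : recursive_in phi (fun _ : 1.-tuple nat => 0%N) by exact: recursive_const.
case: (intP z) f rf hf => [|m|m] f rf hf.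
- exists f, (fun=> 0%N); split=> // n; move: (hf n).
  by rewrite subr0.
- by exists f, (fun=> 0%N); split=> // n; rewrite subr0; exact: hf.
- exists (fun=> 0%N), f; split=> // n; move: (hf n).
  by rewrite sub0r opprK mulrNz mulNr mulrN -normrN opprD opprK.
Qed.

(** * Calculus and partial fractions *)

(** The difference of the two sides is a polynomial of size at most [M] that vanishes at [M]
    distinct points. *)
Lemma lagrange_interpolation (F : fieldType) (M : nat) (a : 'I_M -> F)
    (P : {poly F}) (x : F) : injective a -> (size P <= M)%N ->
  P.[x] = \sum_i P.[a i] * \prod_(l | l != i) ((x - a l) / (a i - a l)).
Proof.
move=> inj_a sP.
pose L i := \prod_(l | l != i) ((a i - a l)^-1 *: ('X - (a l)%:P)).
have LE i y : (L i).[y] = \prod_(l | l != i) ((y - a l) / (a i - a l)).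
  rewrite horner_prod; apply: eq_bigr => l _.
  by rewrite hornerZ hornerXsubC mulrC.
have sL i : (size (L i) <= M)%N.
  have -> : L i = (\prod_(l | l != i) (a i - a l)^-1) *: \prod_(l | l != i) ('X - (a l)%:P).
    by rewrite /L -scaler_prod.
  apply: leq_trans (size_scale_leq _ _) _.
  rewrite -big_filter size_prod_XsubC size_filter -sum1_count.
  rewrite (eq_bigl (mem (predC1 i))) // sum1_card cardC1 card_ord.
  by case: M {a inj_a sP L LE} i => [[]|].
pose Q := P - \sum_i P.[a i] *: L i.
have Q0 : Q = 0.
  apply: (@roots_geq_poly_eq0 _ _ (codom a)).
  - apply/allP => _ /codomP[i ->]; rewrite rootE /Q hornerD hornerN horner_sum.
    rewrite (bigD1 i) //= big1 ?addr0 => [|l li].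
      rewrite hornerZ LE big1 ?mulr1 ?subrr // => l li.
      by rewrite divff // subr_eq0; apply: contraNneq li => /inj_a ->.
    by rewrite hornerZ LE (bigD1 i) ?[i == l]eq_sym //= subrr !(mul0r, mulr0).
  - by rewrite codomE map_inj_uniq ?enum_uniq.
  - rewrite size_codom card_ord; apply: leq_trans (size_polyD _ _) _.
    rewrite size_polyN geq_max sP /=; apply: (leq_trans (size_sum _ _ _)).
    by apply/bigmax_leqP => i _; apply: leq_trans (size_scale_leq _ _) _.
move: Q0 => /eqP; rewrite subr_eq0 => /eqP {1}->.
by rewrite horner_sum; apply: eq_bigr => i _; rewrite hornerZ LE.
Qed.

(** * Derivatives and the inequalities they give *)

Section Calculus.
Local Open Scope classical_set_scope.
Variable R : realType.

Lemma is_derive1_eq (f : R -> R) (x d d' : R) :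
  is_derive x 1 f d -> d = d' -> is_derive x 1 f d'.
Proof. by move=> ? <-. Qed.

Lemma is_derive1_sum (n : nat) (h : 'I_n -> R -> R) (dh : 'I_n -> R) (x : R) :
  (forall i, is_derive x 1 (h i) (dh i)) ->
  is_derive x 1 (fun s => \sum_(i < n) h i s) (\sum_(i < n) dh i).
Proof.
move=> hh; have -> : (fun s => \sum_(i < n) h i s) = \sum_(i < n) h i.
  by apply/funext => s; rewrite fct_sumE.
exact: is_derive_sum.
Qed.

Lemma is_derive1_Ml (c : R) (f : R -> R) (x d : R) :
  is_derive x 1 f d -> is_derive x 1 (fun s => c * f s) (c * d).
Proof. by move=> hf; exact: (@is_deriveZ _ _ _ f c x 1 d hf). Qed.

Lemma is_derive1_D (f g : R -> R) (x d e : R) :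
  is_derive x 1 f d -> is_derive x 1 g e ->
  is_derive x 1 (fun s => f s + g s) (d + e).
Proof. by move=> hf hg; exact: (@is_deriveD _ _ _ f g x 1 d e hf hg). Qed.

Lemma is_derive1_B (f g : R -> R) (x d e : R) :
  is_derive x 1 f d -> is_derive x 1 g e ->
  is_derive x 1 (fun s => f s - g s) (d - e).
Proof. by move=> hf hg; exact: (@is_deriveB _ _ _ f g x 1 d e hf hg). Qed.

Lemma is_derive1_M (f g : R -> R) (x d e : R) :
  is_derive x 1 f d -> is_derive x 1 g e ->
  is_derive x 1 (fun s => f s * g s) (d * g x + f x * e).
Proof.
move=> hf hg; apply: is_derive1_eq (@is_deriveM _ _ f g x 1 d e hf hg) _.
by rewrite addrC /GRing.scale /= [d * _]mulrC.
Qed.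

Lemma is_derive1_affine (c d x : R) :
  is_derive x 1 (fun s : R => c * s + d) c.
Proof.
apply: (is_derive1_eq (is_derive1_D (is_derive1_Ml c (is_derive_id x 1))
  (is_derive_cst d x 1))).
by rewrite mulr1 addr0.
Qed.

Lemma is_derive1_scaled_sqr (c d x : R) :
  is_derive x 1 (fun s : R => d + (s * c) ^+ 2) (2 * x * c ^+ 2).
Proof.
have h : is_derive x 1 (fun s : R => s * c) c.
  have := is_derive1_affine c 0 x; congr is_derive.
  by apply/funext => s; rewrite addr0 mulrC.
apply: (is_derive1_eq (is_derive1_D (is_derive_cst d x 1) (is_derive1_M h h))).
by rewrite /=; ring.
Qed.

Lemma ge0_derive_le (f df : R -> R) (a b : R) : a <= b ->
  (forall x, a <= x <= b -> is_derive x 1 f (df x)) ->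
  (forall x, a <= x <= b -> 0 <= df x) -> f a <= f b.
Proof.
move=> ab hf df0.
have hf' x : x \in `]a, b[%R -> is_derive x 1 f (df x).
  by rewrite in_itv /= => /andP[h1 h2]; apply: hf; rewrite !ltW.
have cf : {within `[a, b], continuous f}.
  apply: derivable_within_continuous => x; rewrite in_itv /= => /hf H.
  exact: ex_derive.
have [c] := MVT_segment ab hf' cf; rewrite in_itv /= => /df0 c0 E.
by rewrite -subr_ge0 E mulr_ge0 // subr_ge0.
Qed.

Lemma exists_antiderivative (f : R -> R) (a : R) : continuous f ->
  exists F : R -> R, forall x, a < x -> is_derive x 1 F (f x).
Proof.
move=> cf; exists (fun x => \int[lebesgue_measure]_(t in `[a, x]) f t)%R => x ax.
have xu : x < x + 1 by rewrite ltrDl.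
have fi : (@lebesgue_measure R).-integrable `[a, x + 1] (EFin \o f).
  apply: continuous_compact_integrable; first exact: segment_compact.
  exact: continuous_subspaceT.
have [dF EF] := continuous_FTC1_closed xu fi ax (cf x).
apply: DeriveDef; first exact: dF.
by rewrite -derive1E.
Qed.

(** Both sides are 1 at [y = 0], so it suffices that the logarithmic derivative
    [sum 2 s / (j^2 + s^2)] of the product is at most [pi]. Each term is at most
    [2 (atan (j / s) - atan ((j - 1) / s))], and these differences telescope to less than [pi]. *)
Lemma prod_1Dsqr_le_expR (M : nat) (y : R) : 0 <= y ->
  \prod_(i < M) (1 + (y / i.+1%:R) ^+ 2) <= expR (pi * y).
Proof.
have Mpos i : (0 : R) < i.+1%:R by rewrite ltr0n.
pose f (s : R) : R := pi * s - \sum_(i < M) ln (1 + (s / i.+1%:R) ^+ 2).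
pose df (s : R) : R := pi - \sum_(i < M) 2 * (s / (i.+1%:R ^+ 2 + s ^+ 2)).
move=> y0.
have pos (i : 'I_M) (s : R) : 0 < 1 + (s / i.+1%:R) ^+ 2.
  by rewrite ltr_pwDl // sqr_ge0.
have hf (s : R) : 0 <= s <= y -> is_derive s 1 f (df s).
  move=> _.
  have hi (i : 'I_M) : is_derive s 1 (fun s => ln (1 + (s / i.+1%:R) ^+ 2))
      (2 * (s / (i.+1%:R ^+ 2 + s ^+ 2))).
    apply: (is_derive1_eq (@is_derive1_comp _ (@ln R) _ s _ _
      (is_derive1_ln (pos i s)) (is_derive1_scaled_sqr i.+1%:R^-1 1 s))).
    have := Mpos i; have := pos i s => h1 h2.
    by field; rewrite !gt_eqF // nat1r ltr_pwDl ?sqr_ge0 ?exprn_gt0.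
  apply: (is_derive1_B _ (is_derive1_sum hi)).
  have := is_derive1_affine pi 0 s; congr is_derive.
  by apply/funext => u; rewrite addr0.
have df0 (s : R) : 0 <= s <= y -> 0 <= df s.
  move=> /andP[s0 _]; rewrite subr_ge0.
  have [->|sn0] := eqVneq s 0.
    by rewrite big1 ?pi_ge0 // => i _; rewrite mul0r mulr0.
  have {}s0 : 0 < s by rewrite lt_def sn0.
  (* The derivative [s / (u^2 + s^2)] of [atan (u / s)] decreases in [u >= 0], hence on this unit
     interval is at least its value at the right end. *)
  have atan_step i : s / (i.+1%:R ^+ 2 + s ^+ 2) <= atan (i.+1%:R / s) - atan (i%:R / s).
    pose g (u : R) : R := atan (u / s) - u * (s / (i.+1%:R ^+ 2 + s ^+ 2)).
    pose dg (u : R) : R := s / (u ^+ 2 + s ^+ 2) - s / (i.+1%:R ^+ 2 + s ^+ 2).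
    have hg (u : R) : i%:R <= u <= i.+1%:R -> is_derive u 1 g (dg u).
      move=> _; have hl c : is_derive u 1 (fun u : R => u * c) c.
        have := is_derive1_affine c 0 u; congr is_derive.
        by apply/funext => v; rewrite addr0 mulrC.
      apply: (is_derive1_B _ (hl _)).
      apply: (is_derive1_eq (@is_derive1_comp _ (@atan R) _ u _ _
        (is_derive1_atan (u / s)) (hl s^-1))).
      have := sqr_ge0 u; have := exprn_gt0 2 s0 => h1 h2.
      by field; rewrite !gt_eqF //; lra.
    have dg0 (u : R) : i%:R <= u <= i.+1%:R -> 0 <= dg u.
      move=> /andP[u1 u2]; rewrite subr_ge0 ler_pM2l //.
      have u0 : 0 <= u by apply: le_trans u1.
      rewrite lef_pV2 ?posrE ?ltr_wpDl ?sqr_ge0 ?exprn_gt0 // lerD2r.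
      by rewrite lerXn2r ?nnegrE.
    have := @ge0_derive_le g dg i%:R i.+1%:R _ hg dg0.
    by rewrite ler_nat leqnSn => /(_ isT); rewrite /g -natr1; lra.
  apply: le_trans (_ : \sum_(i < M) 2 * (atan (i.+1%:R / s) - atan (i%:R / s)) <= _).
    by apply: ler_sum => i _; rewrite ler_pM2l.
  rewrite -mulr_sumr -(big_mkord xpredT (fun i => atan (i.+1%:R / s) - atan (i%:R / s))).
  rewrite telescope_sumr // mul0r atan0 subr0.
  by have := atan_ltpi2 (M%:R / s); lra.
have := ge0_derive_le y0 hf df0.
rewrite /f mulr0 big1 ?subrr => [|i _]; last by rewrite mul0r expr0n addr0 ln1.
rewrite subr_ge0 => h.
apply: le_trans (_ : expR (\sum_(i < M) ln (1 + (y / i.+1%:R) ^+ 2)) <= _); last first.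
  by rewrite ler_expR.
by rewrite expR_sum; apply: ler_prod => i _; rewrite lnK ?posrE // ltW //=.
Qed.

Lemma is_derive1_expRM (c x : R) :
  is_derive x 1 (fun s => expR (c * s)) (c * expR (c * x)).
Proof.
have h := is_derive1_Ml c (is_derive_id x 1).
apply: (is_derive1_eq (@is_derive1_comp _ (@expR R) _ x _ _ (is_derive_expR _) h)).
by rewrite mulr1 mulrC.
Qed.

Lemma continuous_expRM (c : R) : continuous (fun s : R => expR (c * s)).
Proof.
move=> x; apply: differentiable_continuous; apply/derivable1_diffP.
by have h := is_derive1_expRM c x; exact: ex_derive.
Qed.

(** Comparison with the antiderivative [expR (c s) / c], where [c] may be negative: it will be [q]
    towards minus infinity and [q - 2] towards plus infinity. *)
Lemma antiderivative_le_expR (psi g : R -> R) (c x y : R) : c != 0 -> x <= y ->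
  (forall s, x <= s <= y -> is_derive s 1 psi (g s)) ->
  (forall s, g s <= expR (c * s)) ->
  psi y - psi x <= (expR (c * y) - expR (c * x)) / c.
Proof.
move=> c0 xy hpsi hg.
pose f (s : R) : R := c^-1 * expR (c * s) - psi s.
have hf (s : R) : x <= s <= y -> is_derive s 1 f (expR (c * s) - g s).
  move=> /hpsi h; apply: (is_derive1_eq
    (is_derive1_B (is_derive1_Ml c^-1 (is_derive1_expRM c s)) h)).
  by rewrite mulrA mulVf // mul1r.
have := @ge0_derive_le f (fun s => expR (c * s) - g s) x y xy hf.
have h0 (s : R) : x <= s <= y -> 0 <= expR (c * s) - g s by rewrite subr_ge0.
move=> /(_ h0); rewrite /f mulrBl ![_ / c]mulrC; lra.
Qed.

(** * Partial fractions with poles at minus the squares 1, 4, 9, .. *)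

Definition node (i : nat) : R := i.+1%:R ^+ 2.

(** The residue of [1 / prod (x + node l)] at [x = - node i]; up to a common sign, also the weight
    of the [i]-th node in a divided difference. *)
Definition pfcoef (M : nat) (i : 'I_M) : R :=
  \prod_(l < M | l != i) (node l - node i)^-1.

Lemma node_gt0 (i : nat) : 0 < node i.
Proof. by rewrite exprn_gt0. Qed.

Lemma node_inj : injective node.
Proof.
move=> i j /eqP; rewrite /node eqrXn2 // => /eqP h.
by have /eqP := h; rewrite eqr_nat => /eqP [].
Qed.

(** Lagrange interpolation of [X^n] at the points [- node i], divided by the product. *)
Lemma partial_fractions (M n : nat) (x : R) : (n < M)%N -> 0 <= x ->
  x ^+ n / \prod_(i < M) (x + node i) =
  \sum_(i < M) pfcoef i * (- node i) ^+ n / (x + node i).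
Proof.
move=> nM x0; have pos i : 0 < x + node i by rewrite ltr_wpDl ?node_gt0.
have inj_a : injective (fun i : 'I_M => - node i).
  by move=> i j /oppr_inj /node_inj /val_inj.
have sP : (size ('X^n : {poly R}) <= M)%N by rewrite size_polyXn.
have := lagrange_interpolation x inj_a sP; rewrite hornerXn => ->.
rewrite mulr_suml; apply: eq_bigr => i _.
rewrite hornerXn [X in _ / X](bigD1 i) //= invfM big_split /=.
set A := \prod_(l < M | l != i) (x - - node l).
have -> : \prod_(l < M | l != i) (x + node l) = A.
  by apply: eq_bigr => l _; rewrite opprK.
have -> : \prod_(l < M | l != i) (- node i - - node l)^-1 = pfcoef i.
  by apply: eq_bigr => l _; rewrite opprK addrC.
have A0 : A != 0.
  by apply/prodf_neq0 => l _; rewrite opprK gt_eqF.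
by field; rewrite A0 gt_eqF.
Qed.

(** The partial fractions of [x^(n+1)], evaluated at 0. In other words, a divided difference on [M]
    nodes kills polynomials of degree below [M - 1]. *)
Lemma pfcoef_moment0 (M n : nat) : (n.+1 < M)%N ->
  \sum_(i < M) pfcoef i * node i ^+ n = 0.
Proof.
move=> nM; have := partial_fractions nM (lexx 0).
rewrite expr0n mul0r => /esym h.
have : (-1) ^+ n.+1 * \sum_(i < M) pfcoef i * node i ^+ n = 0.
  rewrite -[RHS]h mulr_sumr; apply: eq_bigr => i _.
  rewrite add0r [in RHS]exprNn [node i ^+ n.+1]exprSr.
  have := lt0r_neq0 (node_gt0 i); move: (node i) (node i ^+ n) => x y x0.
  by field.
by move/eqP; rewrite mulf_eq0 signr_eq0 => /eqP.
Qed.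

(* The integrals of the header, in the variable s = ln y: with psi an
   antiderivative of g, the function H s = sum_i d i * psi (s - ln i.+1) has
   derivative dH, and H T - H (- T) tends to S * (total increment of psi). *)
Section PowerMoment.
Variables (M n : nat) (q : R).
Hypotheses (nM : (n < M)%N) (q0 : 0 < q) (q2 : q < 2).
Let p := 2 * n%:R + q.
Let l (i : nat) : R := ln i.+1%:R.
Let d (i : 'I_M) : R := pfcoef i * (- node i) ^+ n * expR ((q - 2) * l i).
Let S : R := \sum_(i < M) d i.
Let g (s : R) : R := expR (q * s) / (1 + expR (2 * s)).
Let dH (s : R) : R := expR (p * s) / \prod_(i < M) (expR (2 * s) + node i).

Let g_cont : continuous g.
Proof.
move=> x; apply: (@continuousM _ _ (fun s => expR (q * s))
  (fun s => (1 + expR (2 * s))^-1)); first exact: continuous_expRM.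
apply: continuousV; first by rewrite gt_eqF // ltr_wpDl // expR_gt0.
apply: cvgD; first exact: cvg_cst.
exact: continuous_expRM.
Qed.

Let g_ge0 s : 0 <= g s.
Proof. by rewrite divr_ge0 ?addr_ge0 ?expR_ge0. Qed.

Let g_le1 s : g s <= expR (q * s).
Proof.
rewrite ler_pdivrMr ?ltr_wpDl ?expR_gt0 // ler_peMr ?expR_ge0 //.
by rewrite lerDl expR_ge0.
Qed.

Let g_le2 s : g s <= expR ((q - 2) * s).
Proof.
rewrite ler_pdivrMr ?ltr_wpDl ?expR_gt0 // mulrDr -expRD -mulrDl subrK.
by rewrite lerDr mulr1 expR_ge0.
Qed.

Let expRl i : expR (l i) = i.+1%:R.
Proof. by rewrite lnK ?posrE. Qed.

(** The partial fraction expansion at [x = expR (2 s)], times [expR (q s)]: since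
    [node i = expR (2 l i)], each pole contributes a translate of [g]. *)
Let sum_g (s : R) : \sum_(i < M) d i * g (s - l i) = dH s.
Proof.
have -> : dH s = expR (q * s) *
    (expR (2 * s) ^+ n / \prod_(i < M) (expR (2 * s) + node i)).
  rewrite /dH /p mulrDl expRD -expRM_natl mulrA; congr (_ / _).
  by rewrite mulrC [n%:R * _]mulrA [n%:R * 2]mulrC.
rewrite partial_fractions ?expR_ge0 // mulr_sumr; apply: eq_bigr => i _.
have nodeE : node i = expR (l i) ^+ 2 by rewrite expRl.
rewrite /d /g nodeE !mulrBr !mulrBl !expRB -!(expRM_natl 2).
have := expR_gt0 (q * l i); have := expR_gt0 (2 * l i) => h1 h2.
have h3 := expR_gt0 (2 * s).
by field; rewrite !gt_eqF // addr_gt0.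
Qed.

Let dH_ge0 s : 0 <= dH s.
Proof.
rewrite divr_ge0 ?expR_ge0 // prodr_ge0 // => i _.
by rewrite addr_ge0 ?expR_ge0 // ltW // node_gt0.
Qed.

(** Equal to [1 / q + 1 / (2 - q)]: the bound on the integral of [g] that follows from [g_le1] to
    the left of 0 and from [g_le2] to the right. The name stands for this bound, not for the
    integral itself. *)
Let I := 2 / (q * (2 - q)).

Let expRN_le (x : R) : 0 < x -> expR (- x) <= x^-1.
Proof.
move=> x0; rewrite expRN lef_pV2 ?posrE ?expR_gt0 //.
by apply: le_trans (expR_ge1Dx x); rewrite lerDr.
Qed.

(** [Delta] is the increment of [psi] over a window [[-T, T]]. The increment of [H] there is bounded
    below, because [dH s >= expR (p s) / P] for [s <= w] and [dH >= 0] beyond, and it exceeds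
    [S * Delta] by at most tails of [g]. *)
Let moment_approx (w del : R) : 0 < del ->
  exists2 Delta, 0 <= Delta <= I &
    expR (p * w) / (p * \prod_(i < M) (expR (2 * w) + node i)) - del <= S * Delta.
Proof.
move=> del0; set P := \prod_(i < M) _.
have p0 : 0 < p by rewrite /p ltr_wpDl // mulr_ge0.
have qq : 0 < 2 - q by rewrite subr_gt0.
have P0 : 0 < P by rewrite prodr_gt0 // => i _; rewrite addr_gt0 ?expR_gt0 ?node_gt0.
pose E : R := \sum_(i < M) `|d i|.
have E0 : 0 <= E by exact: sumr_ge0.
pose L := l M.
have L0 : 0 <= L by rewrite ln_ge0 // ler1n.
have l0 i : 0 <= l i by rewrite ln_ge0 // ler1n.
have lL (i : 'I_M) : l i <= L by rewrite ler_ln ?posrE // ler_nat ltnS ltnW.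
pose C1 := expR ((2 - q) * L) / (2 - q) ^+ 2.
pose C := E * (C1 + (q ^+ 2)^-1) + (p ^+ 2 * P)^-1.
have C10 : 0 <= C1 by rewrite divr_ge0 ?expR_ge0 ?sqr_ge0.
have C0 : 0 <= C.
  apply: addr_ge0; last by rewrite invr_ge0 mulr_ge0 ?sqr_ge0 // ltW.
  by apply: mulr_ge0 => //; apply: addr_ge0 => //; rewrite invr_ge0 sqr_ge0.
(* The window contains [w], and the errors, collected in [C / T], are at most [del]. *)
pose T := `|w| + 1 + C / del.
have T0 : 0 < T by rewrite /T ltr_pwDl ?divr_ge0 ?(ltW del0) // ltr_wpDl.
have CT : C / T <= del.
  rewrite ler_pdivrMr // mulrC -ler_pdivrMr // /T.
  by rewrite lerDr addr_ge0.
have wT : w <= T.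
  apply: le_trans (ler_norm w) _; rewrite /T -addrA lerDl addr_ge0 // divr_ge0 //.
  exact: ltW.
have wNT : - T <= w.
  rewrite lerNl; apply: le_trans (_ : `|w| <= _); first by rewrite -normrN ler_norm.
  by rewrite /T -addrA lerDl addr_ge0 // divr_ge0 // ltW.
(* All arguments [s - l i] with [s >= -T] lie to the right of this starting point, as [l i <= L]. *)
have [psi hpsi] := @exists_antiderivative g (- T - L - 1) g_cont.
have psi_mono x y : - T - L - 1 < x -> x <= y -> psi x <= psi y.
  move=> ax xy; apply: (@ge0_derive_le psi g) => // s /andP[xs _].
  by apply: hpsi; exact: lt_le_trans xs.
have psi_le1 x y : - T - L - 1 < x -> x <= y -> psi y - psi x <= expR (q * y) / q.
  move=> ax xy.
  have h : psi y - psi x <= (expR (q * y) - expR (q * x)) / q.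
    apply: (@antiderivative_le_expR psi g) => //; first by rewrite gt_eqF.
    by move=> s /andP[xs _]; apply: hpsi; exact: lt_le_trans xs.
  apply: le_trans h _; rewrite ler_pM2r ?invr_gt0 // gerBl; exact: expR_ge0.
have psi_le2 x y : - T - L - 1 < x -> x <= y ->
    psi y - psi x <= expR ((q - 2) * x) / (2 - q).
  move=> ax xy.
  have h : psi y - psi x <= (expR ((q - 2) * y) - expR ((q - 2) * x)) / (q - 2).
    apply: (@antiderivative_le_expR psi g) => //; first by rewrite lt_eqF // subr_lt0.
    by move=> s /andP[xs _]; apply: hpsi; exact: lt_le_trans xs.
  apply: le_trans h _.
  rewrite -[leLHS]mulrNN -invrN !opprB ler_pM2r ?invr_gt0 // gerBl.
  exact: expR_ge0.
pose H (s : R) : R := \sum_(i < M) d i * psi (s - l i).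
have hH (s : R) : - T <= s -> is_derive s 1 H (dH s).
  move=> Ts; rewrite -sum_g; apply: is_derive1_sum => i; apply: is_derive1_Ml.
  have ha : is_derive s 1 (fun s : R => s - l i) 1.
    have := is_derive1_affine 1 (- l i) s; congr is_derive.
    by apply/funext => u; rewrite mul1r.
  have hs : - T - L - 1 < s - l i by have := lL i; lra.
  apply: (is_derive1_eq (@is_derive1_comp _ psi _ s _ _ (hpsi _ hs) ha)).
  by rewrite mulr1.
have H1 : H w <= H T.
  apply: (@ge0_derive_le H dH) => // s /andP[h _]; apply: hH; exact: le_trans h.
have H2 : (expR (p * w) - expR (p * - T)) / (p * P) <= H w - H (- T).
  pose f (s : R) : R := H s - (p * P)^-1 * expR (p * s).
  have hf (s : R) : - T <= s <= w -> is_derive s 1 f (dH s - expR (p * s) / P).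
    move=> /andP[h _]; apply: (is_derive1_eq (is_derive1_B (hH _ h)
      (is_derive1_Ml (p * P)^-1 (is_derive1_expRM p s)))).
    by congr (_ - _); field; rewrite !gt_eqF.
  have f0 (s : R) : - T <= s <= w -> 0 <= dH s - expR (p * s) / P.
    move=> /andP[_ h]; rewrite subr_ge0 /dH ler_pM2l ?expR_gt0 // lef_pV2 ?posrE //.
      apply: ler_prod => i _; rewrite addr_ge0 ?expR_ge0 ?(ltW (node_gt0 _)) //=.
      by rewrite lerD2r ler_expR ler_pM2l.
    by rewrite prodr_gt0 // => i _; rewrite addr_gt0 ?expR_gt0 ?node_gt0.
  by have := ge0_derive_le wNT hf f0; rewrite /f mulrBl ![_ / (p * P)]mulrC; lra.
exists (psi T - psi (- T)).
  apply/andP; split.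
    by rewrite subr_ge0; apply: psi_mono; lra.
  have h1 : psi 0 - psi (- T) <= expR (q * 0) / q by apply: psi_le1; lra.
  have h2 : psi T - psi 0 <= expR ((q - 2) * 0) / (2 - q) by apply: psi_le2; lra.
  move: h1 h2; rewrite !mulr0 expR0 !div1r.
  have -> : I = q^-1 + (2 - q)^-1 by rewrite /I; field; rewrite !gt_eqF.
  lra.
have TT : T^-1 * T = 1 by rewrite mulVf // gt_eqF.
have e1 : expR ((q - 2) * (T - L)) / (2 - q) <= C1 / T.
  have -> : (q - 2) * (T - L) = (2 - q) * L + - ((2 - q) * T) by ring.
  rewrite expRD; apply: le_trans (_ : expR ((2 - q) * L) * ((2 - q) * T)^-1 / (2 - q) <= _).
    rewrite ler_pM2r ?invr_gt0 // ler_pM2l ?expR_gt0 //.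
    by apply: expRN_le; rewrite mulr_gt0.
  by rewrite /C1 le_eqVlt; apply/orP; left; apply/eqP; field; rewrite !gt_eqF.
have e2 : expR (q * - T) / q <= (q ^+ 2)^-1 / T.
  rewrite mulrN; apply: le_trans (_ : (q * T)^-1 / q <= _).
    by rewrite ler_pM2r ?invr_gt0 //; apply: expRN_le; rewrite mulr_gt0.
  by rewrite le_eqVlt; apply/orP; left; apply/eqP; field; rewrite !gt_eqF.
have e3 : expR (p * - T) / (p * P) <= (p ^+ 2 * P)^-1 / T.
  rewrite mulrN; apply: le_trans (_ : (p * T)^-1 / (p * P) <= _).
    by rewrite ler_pM2r ?invr_gt0 ?mulr_gt0 //; apply: expRN_le; rewrite mulr_gt0.
  by rewrite le_eqVlt; apply/orP; left; apply/eqP; field; rewrite !gt_eqF.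
(* Translation by [l i] moves both ends of the window to the left, so each increment of [psi]
   changes by one tail of [g] at either end. *)
have H3 : H T - H (- T) <= S * (psi T - psi (- T)) + E * ((C1 + (q ^+ 2)^-1) / T).
  rewrite -lerBlDl /H /S /E !mulr_suml -!sumrB; apply: ler_sum => i _.
  have -> : d i * psi (T - l i) - d i * psi (- T - l i) - d i * (psi T - psi (- T))
    = d i * ((psi (- T) - psi (- T - l i)) - (psi T - psi (T - l i))) by ring.
  apply: le_trans (ler_norm _) _; rewrite normrM ler_wpM2l //.
  have := lL i; have := l0 i => hl0 hlL.
  have a1 : 0 <= psi (- T) - psi (- T - l i) by rewrite subr_ge0; apply: psi_mono; lra.
  have a2 : 0 <= psi T - psi (T - l i) by rewrite subr_ge0; apply: psi_mono; lra.
  have a3 : psi (- T) - psi (- T - l i) <= expR (q * - T) / q by apply: psi_le1; lra.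
  have a4 : psi T - psi (T - l i) <= expR ((q - 2) * (T - l i)) / (2 - q).
    by apply: psi_le2; lra.
  have a5 : expR ((q - 2) * (T - l i)) / (2 - q) <= expR ((q - 2) * (T - L)) / (2 - q).
    rewrite ler_pM2r ?invr_gt0 // ler_expR.
    have -> : (q - 2) * (T - L) = (q - 2) * (T - l i) + (2 - q) * (L - l i) by ring.
    by rewrite lerDl mulr_ge0 ?subr_ge0 // ltW.
  rewrite mulrDl ler_norml; lra.
have : E * ((C1 + (q ^+ 2)^-1) / T) + (p ^+ 2 * P)^-1 / T <= del.
  by apply: le_trans CT; rewrite /C mulrA -mulrDl.
rewrite mulrBl in H2; lra.
Qed.

(** [Delta] depends on [del], and only [0 <= Delta <= I] is known. If [S < 0], the positive left
    side would be at most every [del]; otherwise [S * Delta <= S * I], and [del] tends to 0. *)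
Lemma power_moment_ge (w : R) :
  expR (p * w) / (p * \prod_(i < M) (expR (2 * w) + node i)) <= S * I.
Proof.
set J := _ / _.
have p0 : 0 < p by rewrite /p ltr_wpDl // mulr_ge0.
have J0 : 0 < J.
  rewrite divr_gt0 ?expR_gt0 // mulr_gt0 // prodr_gt0 // => i _.
  by rewrite addr_gt0 ?expR_gt0 ?node_gt0.
have [S0|S0] := leP 0 S.
  rewrite -subr_le0; apply/ler_addgt0Pr => e e0; rewrite add0r.
  have [D /andP[_ DI] h] := moment_approx w e0.
  have : S * D <= S * I by rewrite ler_wpM2l.
  by move: h; rewrite -/J; lra.
have J2 : 0 < J / 2 by rewrite divr_gt0.
have [D /andP[D0 _] h] := moment_approx w J2.
have : S * D <= 0 by rewrite mulr_le0_ge0 // ltW.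
by move: h; rewrite -/J; lra.
Qed.

End PowerMoment.
End Calculus.

(** * The alternating binomial sum *)

Section AlternatingSum.
Variable R : realType.
Local Notation node := (@node R).

(** Here [node l - node i = (l - i) (l + i + 2)], and both factors multiply up to quotients of
    factorials. The denominators are cleared to keep the induction free of division. *)
Lemma prod_node_sub_lt (i j : nat) : (j <= i)%N ->
  (\prod_(0 <= l < j) (node l - node i)) * ((i - j)`! * i.+1`!)%:R =
  (-1) ^+ j * (i`! * (i + j).+1`!)%:R.
Proof.
elim: j => [_|j IH ji]; first by rewrite big_geq // subn0 addn0 expr0 !mul1r.
rewrite big_nat_recr //= exprS addnS [((i + j).+2)`!]factS.
have {}IH := IH (ltnW ji).
rewrite -(subnSK ji) [(i - j.+1).+1`!]factS in IH.
have -> : node j - node i = - ((i - j.+1).+1%:R * (i + j).+2%:R).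
  have E : (i = i - j.+1 + j.+1)%N by rewrite subnK.
  by rewrite /node; move: (i - j.+1)%N E => e ->; ring.
move: IH; set P := \prod_(_ <= _ < _) _.
move: (i.+1`!) ((i + j).+1`!) (i`!) ((i - j.+1)`!) => a b c e; rewrite !natrM => IH.
transitivity (- (i + j).+2%:R * (P * ((i - j.+1).+1%:R * e%:R * a%:R))).
  by ring.
by rewrite IH; ring.
Qed.

(** Induction on the number [t] of nodes above [i], starting from [prod_node_sub_lt] at [j = i]. *)
Lemma prod_node_sub (i t : nat) :
  (\prod_(0 <= l < i.+1 + t | l != i) (node l - node i)) * (2 * node i) =
  (-1) ^+ i * (t`! * (i.+1 + t + i.+1)`!)%:R.
Proof.
elim: t => [|t IH].
  rewrite addn0 big_mkcond big_nat_recr //= eqxx mulr1 -big_mkcond /=.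
  rewrite big_nat_cond (eq_bigl (fun l => (0 <= l < i)%N && true)); last first.
    by move=> l /=; rewrite andbT; case: ltngtP.
  rewrite -big_nat_cond.
  have := prod_node_sub_lt (leqnn i); rewrite subnn fact0 mul1n.
  set P := \prod_(_ <= _ < _) _ => h.
  have i1 : i.+1%:R != 0 :> R by rewrite pnatr_eq0.
  have fi : i`!%:R != 0 :> R by rewrite pnatr_eq0 -lt0n fact_gt0.
  rewrite mul1n addnS [(_ + i).+1`!]factS addSn.
  move: h fi; rewrite factS; move: (i`!) ((i + i).+1`!) => c e; rewrite !natrM => h' fi.
  have -> : (i + i).+2%:R = 2 * i.+1%:R :> R by ring.
  rewrite [X in 2 * X]expr2.
  apply: (mulfI fi).
  transitivity (2 * i.+1%:R * (P * (i.+1%:R * c%:R))); first by ring.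
  by rewrite h'; ring.
rewrite addnS big_mkcond big_nat_recr //= -big_mkcond /=.
have -> : (i.+1 + t != i)%N by rewrite addSn gtn_eqF // ltnS leq_addr.
rewrite mulrAC IH [t.+1`!]factS addSn [((i.+1 + t) + i.+1).+1`!]factS.
move: (t`!) ((i.+1 + t + i.+1)`!) => c e; rewrite !natrM.
have -> : node (i.+1 + t) - node i = t.+1%:R * (i.+1 + t + i.+1).+1%:R.
  by rewrite /node; ring.
by ring.
Qed.

Lemma pfcoefE (M : nat) (i : 'I_M) :
  pfcoef R i = (-1) ^+ i * 2 * node i / ((M - i.+1)`! * (M + i.+1)`!)%:R.
Proof.
have E : (M = i.+1 + (M - i.+1))%N by rewrite subnKC.
have := prod_node_sub i (M - i.+1); rewrite -E.
rewrite /pfcoef prodfV -(big_mkord (fun l => l != i :> nat) (fun l => node l - node i)).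
set P := \prod_(_ <= _ < _ | _) _; set F := ((M - i.+1)`! * (M + i.+1)`!)%:R.
have F0 : F != 0 by rewrite pnatr_eq0 -lt0n muln_gt0 !fact_gt0.
have n0 : node i != 0 by rewrite gt_eqF ?node_gt0.
have s2 : (-1) ^+ i * (-1) ^+ i = 1 :> R by rewrite -exprD addnn -mul2n exprM sqrrN !expr1n.
move=> h.
have P0 : P != 0.
  by apply: contra_eq_neq h => ->; rewrite mul0r eq_sym mulf_neq0 // signr_eq0.
apply: (mulfI P0); rewrite divff //; apply: (mulIf F0).
rewrite mul1r.
transitivity ((-1) ^+ i * (P * (2 * node i))); last by rewrite -[RHS]mulrA divfK //; ring.
by rewrite h mulrA s2 mul1r.
Qed.

Definition altsum (M : nat) (p : R) : R :=
  \sum_(i < M) (-1) ^+ i.+1 * ('C(M.*2, M + i.+1))%:R * i.+1%:R `^ p.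

(** By [pfcoefE] the binomial coefficients are, up to sign and the factor [(2M)! / 2], the weights
    [pfcoef] divided by the nodes. The remaining factor [(i + 1)^(p - 2)] is [x^(p/2 - 1)] at
    [x = node i]. *)
Lemma altsumE (M : nat) (p : R) :
  altsum M p = - ((M.*2)`!%:R / 2) * \sum_(i < M) pfcoef R i * i.+1%:R `^ (p - 2).
Proof.
rewrite /altsum mulr_sumr; apply: eq_bigr => i _.
have i0 : (0 : R) < i.+1%:R by rewrite ltr0n.
have -> : i.+1%:R `^ p = node i * i.+1%:R `^ (p - 2).
  rewrite /node -powR_mulrn ?ltW // -powRD ?(gt_eqF i0) ?implybT //.
  by congr (_ `^ _); rewrite subrKC.
have iM : (M + i.+1 <= M.*2)%N by rewrite -addnn leq_add2l.
have := bin_fact iM; rewrite -addnn subnDl => <-.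
rewrite pfcoefE !natrM.
have f1 : ((M + i.+1)`!%:R : R) != 0 by rewrite pnatr_eq0 -lt0n fact_gt0.
have f2 : ((M - i.+1)`!%:R : R) != 0 by rewrite pnatr_eq0 -lt0n fact_gt0.
rewrite exprS; field; rewrite f1 f2 //.
Qed.

Lemma altsum_even (M n : nat) : (n.+1 < M)%N -> altsum M (2 * n.+1%:R) = 0.
Proof.
move=> nM; rewrite altsumE -[RHS](mulr0 (- ((M.*2)`!%:R / 2))); congr (_ * _).
rewrite -[RHS](pfcoef_moment0 R nM); apply: eq_bigr => i _; congr (_ * _).
rewrite (_ : 2 * n.+1%:R - 2 = (2 * n)%:R); last by ring.
by rewrite powR_mulrn // exprM.
Qed.

Lemma sin_le_id (x : R) : 0 <= x -> sin x <= x.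
Proof.
move=> x0; have hf (s : R) : 0 <= s <= x -> is_derive s 1 (fun s => s - sin s) (1 - cos s).
  by move=> _; exact: (is_derive1_B (is_derive_id s 1) (is_derive_sin s)).
have h0 (s : R) : 0 <= s <= x -> 0 <= 1 - cos s by move=> _; rewrite subr_ge0 cos_le1.
by have := ge0_derive_le x0 hf h0; rewrite sin0 subr0 subr_ge0.
Qed.

(** Up to sign the sine is [sin (pi q / 2) = sin (pi (2 - q) / 2)], hence at most [pi / 2] times the
    smaller of [q] and [2 - q]; the larger one is at least 1. *)
Lemma norm_sin_le (n : nat) (q : R) : 0 <= q <= 2 ->
  `|sin (pi * (2 * n%:R + q) / 2)| <= pi / 2 * (q * (2 - q)).
Proof.
move=> /andP[q0 q2]; have pi0 := pi_gt0 R.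
have -> : pi * (2 * n%:R + q) / 2 = pi * q / 2 + pi *+ n by field.
rewrite (alternatingn (@sinDpi R)) normrM normrX normrN1 expr1n mul1r.
have h0 : 0 <= pi * q / 2 by rewrite divr_ge0 ?mulr_ge0 // ltW.
have h1 : 0 <= pi - pi * q / 2.
  have -> : pi - pi * q / 2 = pi * (2 - q) / 2 by field.
  by rewrite divr_ge0 ?mulr_ge0 ?subr_ge0 // ltW.
rewrite ger0_norm; last by apply: sin_ge0_pi; lra.
have [q1|q1] := leP q 1.
  apply: le_trans (sin_le_id h0) _.
  have -> : pi * q / 2 = pi / 2 * q by field.
  by rewrite ler_pM2l ?divr_gt0 // ler_peMr //; lra.
have -> : sin (pi * q / 2) = sin (pi - pi * q / 2) by rewrite sinB sinpi cospi; ring.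
apply: le_trans (sin_le_id h1) _.
have -> : pi - pi * q / 2 = pi / 2 * (2 - q) by field.
by rewrite ler_pM2l ?divr_gt0 // ler_peMl //; lra.
Qed.

Lemma altsum_ge (M n : nat) (q p : R) : (n < M)%N -> 0 < q -> q < 2 ->
  p = 2 * n%:R + q ->
  `|sin (pi * p / 2)| / (2 * pi * p) * 'C(M.*2, M)%:R * (p / (expR 1 * pi)) `^ p
    <= (-1) ^+ n.+1 * altsum M p.
Proof.
move=> nM q0 q2 pE; have pi0 := pi_gt0 R.
have p0 : 0 < p by rewrite pE ltr_wpDl // mulr_ge0.
pose S : R := \sum_(i < M) pfcoef R i * (- node i) ^+ n * expR ((q - 2) * ln i.+1%:R).
have -> : (-1) ^+ n.+1 * altsum M p = (M.*2)`!%:R / 2 * S.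
  rewrite altsumE; transitivity ((M.*2)`!%:R / 2 *
      ((-1) ^+ n * \sum_(i < M) pfcoef R i * i.+1%:R `^ (p - 2))).
    by rewrite exprS; ring.
  congr (_ * _); rewrite mulr_sumr; apply: eq_bigr => i _.
  rewrite [in RHS]exprNn mulrCA -!mulrA; do 2 congr (_ * _).
  rewrite -exprM -powR_mulrn // /powR ifF ?pnatr_eq0 // -expRD -mulrDl.
  by congr expR; congr (_ * _); rewrite pE natrM; ring.
(* The point [y = p / pi] maximizes [y^p expR (- pi y)], which the lower bound becomes after
   [prod_1Dsqr_le_expR]. *)
have := power_moment_ge nM q0 q2 (ln (p / pi)); rewrite -/S -pE.
have Y0 : 0 < p / pi by rewrite divr_gt0.
set P := \prod_(i < M) _.
have P0 : 0 < P by rewrite prodr_gt0 // => i _; rewrite addr_gt0 ?expR_gt0 ?node_gt0.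
have PE : P <= (M`!%:R) ^+ 2 * expR p.
  have -> : P = (M`!%:R) ^+ 2 * \prod_(i < M) (1 + (p / pi / i.+1%:R) ^+ 2).
    rewrite fact_prod natr_prod big_add1 big_mkord /= -prodrXl -big_split /=.
    apply: eq_bigr => i _; rewrite (expRM_natl 2) lnK ?posrE // /node.
    by move: (p / pi) => Y; field; rewrite nat1r pnatr_eq0.
  rewrite ler_pM2l ?exprn_gt0 ?ltr0n ?fact_gt0 //.
  apply: le_trans (prod_1Dsqr_le_expR M (ltW Y0)) _.
  by rewrite mulrCA divff ?gt_eqF // mulr1.
have I0 : 0 < q * (2 - q) by rewrite mulr_gt0 // subr_gt0.
have sq : `|sin (pi * p / 2)| <= pi / 2 * (q * (2 - q)).
  by rewrite pE; apply: norm_sin_le; rewrite !ltW.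
rewrite mulrA ler_pdivlMr // => hS.
have -> : (p / (expR 1 * pi)) `^ p = expR (p * ln (p / pi)) / expR p.
  rewrite /powR gt_eqF ?divr_gt0 ?mulr_gt0 ?expR_gt0 // -expRB; congr expR.
  rewrite (_ : p / (expR 1 * pi) = expR (-1) * (p / pi)); last first.
    by rewrite expRN invfM mulrCA.
  by rewrite lnM ?posrE ?expR_gt0 // expRK; ring.
set N := expR (p * ln (p / pi)) in hS *.
have N0 : 0 < N by exact: expR_gt0.
have cb : 'C(M.*2, M)%:R * M`!%:R ^+ 2 = (M.*2)`!%:R :> R.
  rewrite expr2 -!natrM; congr (_%:R).
  by have := @bin_fact M.*2 M; rewrite -addnn leq_addr addnK; apply.
rewrite -cb; set f := M`!%:R ^+ 2 in PE *.
have f0 : 0 < f by rewrite exprn_gt0 // ltr0n fact_gt0.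
have h1 : N / (f * expR p) <= N / P.
  by rewrite ler_pM2l // lef_pV2 ?posrE ?mulr_gt0 ?expR_gt0.
have h2 : `|sin (pi * p / 2)| / pi * (N / (f * expR p)) / p <= S.
  have : (pi / 2 * (q * (2 - q))) / pi * (N / P) / p <= S.
    apply: le_trans (_ : S * 2 / 2 <= _); last by rewrite mulfK.
    rewrite ler_pdivlMr //; apply: le_trans hS; rewrite le_eqVlt; apply/orP; left.
    apply/eqP; move: (@pi R) (lt0r_neq0 pi0) => x x0.
    by field; rewrite x0 !gt_eqF.
  apply: le_trans; rewrite ler_pM2r ?invr_gt0 //; apply: ler_pM => //.
  - by rewrite divr_ge0 // ltW.
  - by rewrite divr_ge0 ?mulr_ge0 ?expR_ge0 // ltW.
  - by rewrite ler_pM2r ?invr_gt0.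
apply: le_trans (_ : 'C(M.*2, M)%:R * f / 2 *
   (`|sin (pi * p / 2)| / pi * (N / (f * expR p)) / p) <= _); last first.
  by rewrite ler_wpM2l // divr_ge0 // mulr_ge0 // ltW.
rewrite le_eqVlt; apply/orP; left; apply/eqP.
move: (`|sin (pi * p / 2)|) (@pi R) (lt0r_neq0 pi0) => s x x0.
by field; rewrite x0 !gt_eqF ?expR_gt0.
Qed.

(** Induction: passing from [m] to [m + 1] multiplies the central binomial coefficient by
    [2 (2m + 1) / (m + 1)], and [(2m + 1)^2 >= 4m (m + 1)]. *)
Lemma central_binomial_sqr_ge (M : nat) : (0 < M)%N ->
  (4 ^ M * 4 ^ M <= 4 * M * 'C(M.*2, M) ^ 2)%N.
Proof.
elim: M => // -[_ _|M IH _]; first by [].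
have {}IH := IH isT; set m := M.+1 in IH *.
have rec : (m.+1 * 'C(m.+1.*2, m.+1) = 2 * m.*2.+1 * 'C(m.*2, m))%N.
  have h1 := mul_bin_diag m.*2.+2 m.
  have h2 := mul_bin_down m.*2.+1 m.
  rewrite -addnn subSn ?leq_addr // addnK addnn /= in h2.
  rewrite doubleS -h1 /=; apply/eqP; rewrite -(eqn_pmul2l (ltn0Sn m)); apply/eqP.
  rewrite mulnCA -h2; lia.
rewrite -(leq_pmul2l (ltn0Sn m)).
apply: (@leq_trans (4 * (m.+1 * 'C(m.+1.*2, m.+1)) ^ 2)); last first.
  by rewrite leq_eqVlt; apply/orP; left; apply/eqP; lia.
rewrite rec; move: IH; rewrite !expnS; move: (4 ^ m)%N 'C(m.*2, m) => a c.
rewrite -muln2 !expn0 !muln1 => IH; nia.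
Qed.

End AlternatingSum.

(** * Moment estimates *)

Section MomentBounds.
Variable R : realType.

(** [cosh s] times [expR (- s^2 / 2)] does not increase for [s >= 0] because [sinh s <= s cosh s],
    which holds because [s cosh s - sinh s] has derivative [s sinh s]. *)
Lemma cosh_le_expR (x : R) : 0 <= x ->
  expR x + expR (- x) <= 2 * expR (x ^+ 2 / 2).
Proof.
move=> x0.
have dp (s : R) : is_derive s 1 expR (expR s) by exact: is_derive_expR.
have dm (s : R) : is_derive s 1 (fun s => expR (- s)) (- expR (- s)).
  apply: (is_derive1_eq (@is_derive1_comp _ (@expR R) _ s _ _
    (is_derive_expR _) (is_deriveNid s 1))).
  by rewrite mulrN1.
have sinh_le (y : R) : 0 <= y -> expR y - expR (- y) <= y * (expR y + expR (- y)).
  move=> y0.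
  pose f (s : R) : R := s * (expR s + expR (- s)) - (expR s - expR (- s)).
  have hf (s : R) : 0 <= s <= y -> is_derive s 1 f (s * (expR s - expR (- s))).
    move=> _; apply: (is_derive1_eq (is_derive1_B (is_derive1_M (is_derive_id s 1)
      (is_derive1_D (dp s) (dm s))) (is_derive1_B (dp s) (dm s)))).
    by rewrite /=; ring.
  have f0 (s : R) : 0 <= s <= y -> 0 <= s * (expR s - expR (- s)).
    move=> /andP[s0 _]; rewrite mulr_ge0 // subr_ge0 ler_expR; lra.
  by have := ge0_derive_le y0 hf f0; rewrite /f mul0r oppr0 expR0 subrr subr0 subr_ge0.
have dq (s : R) : is_derive s 1 (fun s => expR (- (s ^+ 2 / 2))) (- s * expR (- (s ^+ 2 / 2))).
  have h : is_derive s 1 (fun s : R => - (s ^+ 2 / 2)) (- s).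
    have := is_derive1_Ml (- 2^-1) (is_derive1_scaled_sqr 1 0 s).
    move=> h; have := is_derive1_eq h (_ : _ = - s).
    have E : (fun s : R => - 2^-1 * (0 + (s * 1) ^+ 2)) = (fun s : R => - (s ^+ 2 / 2)).
      by apply/funext => u; rewrite add0r mulr1; field.
    by rewrite E; apply; field.
  apply: (is_derive1_eq (@is_derive1_comp _ (@expR R) _ s _ _ (is_derive_expR _) h)).
  by rewrite mulrC.
pose g (s : R) : R := -1 * ((expR s + expR (- s)) * expR (- (s ^+ 2 / 2))).
pose dg (s : R) : R := (s * (expR s + expR (- s)) - (expR s - expR (- s)))
   * expR (- (s ^+ 2 / 2)).
have hg (s : R) : 0 <= s <= x -> is_derive s 1 g (dg s).
  move=> _; apply: (is_derive1_eq (is_derive1_Ml (-1)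
    (is_derive1_M (is_derive1_D (dp s) (dm s)) (dq s)))).
  by rewrite /dg; ring.
have g0 (s : R) : 0 <= s <= x -> 0 <= dg s.
  by move=> /andP[s0 _]; rewrite mulr_ge0 ?expR_ge0 // subr_ge0 sinh_le.
have := ge0_derive_le x0 hg g0; rewrite /g oppr0 expr0n mul0r oppr0 expR0.
have := expR_gt0 (x ^+ 2 / 2) => e0.
rewrite [expR (- (x ^+ 2 / 2))]expRN => h.
have {}h : (expR x + expR (- x)) / expR (x ^+ 2 / 2) <= 2 by lra.
by move: h; rewrite ler_pdivrMr.
Qed.

(** The maximum of [y^p expR (- lam y)] over [y > 0], attained at [y = p / lam], is
    [(p / (e lam))^p]; the two exponentials together dominate [expR (lam |x|)]. *)
Lemma powR_le_expRD (p lam x : R) : 0 < p -> 0 < lam ->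
  `|x| `^ p <= (p / (expR 1 * lam)) `^ p * (expR (lam * x) + expR (- (lam * x))).
Proof.
move=> p0 lam0.
have [->|xn0] := eqVneq x 0.
  by rewrite normr0 powR0 ?gt_eqF // mulr_ge0 ?powR_ge0 // addr_ge0 ?expR_ge0.
have x0 : 0 < `|x| by rewrite normr_gt0.
apply: le_trans (_ : (p / (expR 1 * lam)) `^ p * expR (lam * `|x|) <= _); last first.
  rewrite ler_wpM2l ?powR_ge0 //; have [h|h] := ger0P x.
    by rewrite lerDl expR_ge0.
  by rewrite mulrN lerDr expR_ge0.
rewrite /powR gt_eqF // gt_eqF ?divr_gt0 ?mulr_gt0 ?expR_gt0 // -expRD ler_expR.
have z0 : 0 < lam * `|x| / p by rewrite divr_gt0 ?mulr_gt0.
have h := ln_le_sub1 z0.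
move: h; rewrite !(ln_div, lnM) ?posrE ?mulr_gt0 ?expR_gt0 // expRK => h.
have : p * (ln lam + ln `|x| - ln p) <= p * (lam * `|x| / p - 1) by rewrite ler_pM2l.
have -> : p * (lam * `|x| / p - 1) = lam * `|x| - p by field; rewrite gt_eqF.
lra.
Qed.

(** The choice [lam = sqrt (p / K)] minimizes [(p / (e lam))^p expR (lam^2 / 2)^K], the bound that
    exponential moments give. *)
Lemma moment_const (p K : R) : 0 < p -> 0 < K ->
  (p / (expR 1 * Num.sqrt (p / K))) `^ p * expR (Num.sqrt (p / K) ^+ 2 / 2) `^ K
  = (p * K / expR 1) `^ (p / 2).
Proof.
move=> p0 K0; have e0 := expR_gt0 (1 : R).
have r0 : 0 < p / K by rewrite divr_gt0.
have s0 : 0 < Num.sqrt (p / K) by rewrite sqrtr_gt0.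
rewrite sqr_sqrtr ?ltW // -expRM.
rewrite {1}/powR gt_eqF ?divr_gt0 ?mulr_gt0 // -expRD.
rewrite /powR gt_eqF ?divr_gt0 ?mulr_gt0 //; congr expR.
have ls : ln (Num.sqrt (p / K)) = (ln p - ln K) / 2.
  rewrite -powR12_sqrt ?ltW // ln_powR ln_div ?posrE //; by field.
rewrite !(ln_div, lnM) ?posrE ?mulr_gt0 // ls expRK.
by field; rewrite gt_eqF.
Qed.

Lemma expR1_ge : 5 / 2 <= expR 1 :> R.
Proof.
apply: le_trans (_ : (1 + 6^-1) ^+ 6 <= _); first by lra.
have -> : expR 1 = expR 6^-1 ^+ 6 :> R by rewrite -expRM_natl divff.
by rewrite lerXn2r ?nnegrE ?expR_ge0 ?expR_ge1Dx //; lra.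
Qed.

(** On the left the bound for the absolute moment times the claimed bound, on the right the lower
    bound for the alternating moment, both without common factors. After squaring, [(a b)^p]
    cancels, and the rest follows from [(2 e k / K)^p >= (3/2) e p] and [e >= 5/2]. *)
Lemma bound_comparison (p k K M : R) : 1 <= p -> 0 < k -> 3 * K <= 4 * k ->
  0 < M -> K = 2 * M ->
  (p * K / expR 1) `^ (p / 2)
    * (2 * p / (expR 1 ^+ 2 * pi ^+ 2 * k)) `^ ((p + 1) / 2)
  <= 2 `^ p / (4 * pi * Num.sqrt M) * (p / (expR 1 * pi)) `^ p.
Proof.
move=> p1 k0 Kk M0 KE; have e0 := expR_gt0 (1 : R); have pi0 := pi_gt0 R.
have p0 : 0 < p by lra.
have K0 : 0 < K by lra.
have sM : 0 < Num.sqrt M by rewrite sqrtr_gt0.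
have half (a s : R) : 0 < a -> a `^ (s / 2) ^+ 2 = a `^ s.
  by move=> a0; rewrite -powR_mulrn ?powR_ge0 // -powRrM divfK.
have sq (a s : R) : 0 < a -> a `^ s ^+ 2 = (a ^+ 2) `^ s.
  by move=> a0; rewrite !expr2 powRM // ltW.
rewrite -(@ler_pXn2r _ 2) ?nnegrE ?mulr_ge0 ?powR_ge0 ?invr_ge0 ?mulr_ge0
  ?(ltW sM) ?(ltW pi0) //.
set a := p * K / expR 1; set b := 2 * p / _.
have a0 : 0 < a by rewrite divr_gt0 ?mulr_gt0.
have b0 : 0 < b by rewrite divr_gt0 ?mulr_gt0 ?exprn_gt0.
have c0 : 0 < p / (expR 1 * pi) by rewrite divr_gt0 ?mulr_gt0.
rewrite !exprMn (half a p a0) (half b (p + 1) b0) exprVn !exprMn.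
rewrite (sqr_sqrtr (ltW M0)) (sq 2 p (ltr0Sn _ _)) (sq _ p c0).
rewrite powRD ?(gt_eqF b0) ?implybT // powRr1 ?(ltW b0) // mulrA.
rewrite -powRM ?(ltW a0) ?(ltW b0) //.
have -> : (2 ^+ 2) `^ p / (4 ^+ 2 * pi ^+ 2 * M) * ((p / (expR 1 * pi)) ^+ 2) `^ p =
   (a * b) `^ p * (2 * expR 1 * k / K) `^ p / (4 ^+ 2 * pi ^+ 2 * M).
  have -> : (2 ^+ 2) `^ p / (4 ^+ 2 * pi ^+ 2 * M) * ((p / (expR 1 * pi)) ^+ 2) `^ p =
    (2 ^+ 2) `^ p * ((p / (expR 1 * pi)) ^+ 2) `^ p / (4 ^+ 2 * pi ^+ 2 * M) by ring.
  have h1 : 0 <= 2 ^+ 2 :> R by rewrite exprn_ge0.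
  have h2 : 0 <= (p / (expR 1 * pi)) ^+ 2 by rewrite sqr_ge0.
  have h3 : 0 <= a * b by rewrite mulr_ge0 // ltW.
  have h4 : 0 <= 2 * expR 1 * k / K by rewrite ltW // divr_gt0 ?mulr_gt0.
  rewrite -(powRM _ h1 h2) -(powRM _ h3 h4).
  congr (_ `^ _ / _); rewrite /a /b.
  move: (@pi R) (lt0r_neq0 pi0) (expR 1 : R) (lt0r_neq0 e0) => x x0 y y0.
  by field; rewrite x0 y0 !gt_eqF.
rewrite -mulrA (ler_pM2l (powR_gt0 _ (mulr_gt0 a0 b0))).
have rE : 3 / 2 * expR 1 <= 2 * expR 1 * k / K.
  rewrite ler_pdivlMr //.
  have : expR 1 * (3 * K) <= expR 1 * (4 * k) by rewrite ler_pM2l.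
  lra.
have r0 : 0 < 2 * expR 1 * k / K by rewrite divr_gt0 ?mulr_gt0.
(* The base is at least [(3/2) e]; one such factor is split off, and the others give at least
   [e^(p - 1) >= p]. *)
have hr : 3 / 2 * expR 1 * p <= (2 * expR 1 * k / K) `^ p.
  apply: le_trans (_ : (3 / 2 * expR 1) `^ p <= _); last first.
    apply: ge0_ler_powR => //; first exact: ltW.
      by rewrite nnegrE mulr_ge0 // ltW.
    by rewrite nnegrE ltW.
  have z0 : 0 < 3 / 2 * expR 1 :> R by lra.
  rewrite -{2}(subrKC 1 p) powRD ?(gt_eqF z0) ?implybT //.
  rewrite powRr1 ?mulr_ge0 ?(ltW e0) // ler_pM2l ?mulr_gt0 //.
  apply: le_trans (_ : expR 1 `^ (p - 1) <= _).
    by rewrite -expRM mul1r; have := expR_ge1Dx (p - 1); rewrite subrKC.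
  by apply: ge0_ler_powR; rewrite ?nnegrE; lra.
apply: le_trans (_ : 3 / 2 * expR 1 * p / (4 ^+ 2 * pi ^+ 2 * M) <= _); last first.
  by rewrite ler_pM2r // invr_gt0 !mulr_gt0 ?exprn_gt0.
rewrite /b KE in Kk *.
have e3 : 32 / 3 * M <= expR 1 ^+ 3 * k / 2.
  have e1 := expR1_ge.
  have : (5 / 2) ^+ 3 <= expR 1 ^+ 3 :> R by rewrite lerXn2r ?nnegrE //; lra.
  move: (expR 1 ^+ 3) => z hz.
  have : (5 / 2) ^+ 3 * k <= z * k by rewrite ler_pM2r.
  lra.
have pp : 0 < pi ^+ 2 :> R by rewrite exprn_gt0.
rewrite ler_pdivrMr ?mulr_gt0 ?exprn_gt0 // mulrAC ler_pdivlMr ?mulr_gt0 ?exprn_gt0 //.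
have -> : 2 * p * (4 ^+ 2 * pi ^+ 2 * M) = (p * pi ^+ 2 * 3) * (32 / 3 * M) by field.
have -> : 3 / 2 * expR 1 * p * (expR 1 ^+ 2 * pi ^+ 2 * k) =
  (p * pi ^+ 2 * 3) * (expR 1 ^+ 3 * k / 2) by field.
by rewrite ler_pM2l // !mulr_gt0.
Qed.

End MomentBounds.

(** * Sums over sign vectors *)

Section SignSums.
Variable R : realType.

(** With [q = p - 2n], the case [q > 0] is [altsum_ge]; for [q = 0] both the sine and the
    alternating sum vanish. *)
Lemma altsum_bound (M n : nat) (p : R) : 1 <= p -> p < M.*2%:R ->
  n%:R <= p / 2 -> p / 2 < n%:R + 1 ->
  `|sin (pi * p / 2)| / (2 * pi * p) * 'C(M.*2, M)%:R * (p / (expR 1 * pi)) `^ p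
    <= (-1) ^+ n.+1 * altsum M p.
Proof.
move=> p1 pM n1 n2.
have pE : p = 2 * n%:R + (p - 2 * n%:R) by ring.
have nM : (n < M)%N by rewrite -ltn_double -(ltr_nat R) -muln2 natrM; lra.
have [q0|q0] := ltP 0 (p - 2 * n%:R); first by apply: altsum_ge nM q0 _ pE; lra.
have {}pE : p = 2 * n%:R by lra.
case: n nM pE n1 n2 q0 => [|n] nM pE n1 n2 q0; first by lra.
rewrite [X in altsum M X]pE altsum_even // mulr0.
have := @norm_sin_le R n.+1 0; rewrite addr0 mul0r mulr0 lexx ler0n -pE => /(_ isT).
by rewrite normr_le0 => /eqP ->; rewrite normr0 !mul0r.
Qed.

Lemma sum_boolvec_card (k : nat) (F : nat -> R) :
  \sum_(v : boolvec k) F (\sum_(i < k) v i)%N =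
  \sum_(j < k.+1) 'C(k, j)%:R * F j.
Proof.
have w_le (v : boolvec k) : (\sum_(i < k) v i < k.+1)%N.
  rewrite ltnS -[leqRHS]card_ord -sum1_card; apply: leq_sum => i _.
  by case: (v i).
rewrite (partition_big (fun v : boolvec k => Ordinal (w_le v)) xpredT) //=.
apply: eq_bigr => j _.
rewrite (eq_bigr (fun=> F j)); last by move=> v /eqP <-.
rewrite (eq_bigl (mem [set v : boolvec k | (\sum_(i < k) v i)%N == j])); last first.
  by move=> v; rewrite /= inE.
rewrite sumr_const -[LHS]mulr_natl; congr (_%:R * _).
pose f (v : boolvec k) : {set 'I_k} := [set i | v i].
have f_inj : injective f.
  by move=> u v /setP h; apply/ffunP => i; have := h i; rewrite !inE.
have := card_draws 'I_k j; rewrite card_ord => <-; rewrite -(card_imset _ f_inj).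
apply: eq_card => A; rewrite !inE; apply/imsetP/idP => [[v + ->]|/eqP hA].
  rewrite inE => /eqP <- /=; rewrite -sum1_card; apply/eqP.
  rewrite big_mkcond /=; apply: eq_bigr => i _; rewrite inE; by case: (v i).
exists [ffun i => i \in A].
  rewrite inE; apply/eqP; rewrite -hA -sum1_card [RHS]big_mkcond.
  by apply: eq_bigr => i _; rewrite ffunE; case: (i \in A).
by apply/setP => i; rewrite inE ffunE.
Qed.

Definition sgnsum (k : nat) (v : boolvec k) : R := \sum_(i < k) (-1) ^+ v i.
Definition sgnprod (k : nat) (v : boolvec k) : R := \prod_(i < k) (-1) ^+ v i.

Lemma sgnsumE (k : nat) (v : boolvec k) :
  sgnsum v = k%:R - 2 * (\sum_(i < k) v i)%N%:R.
Proof.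
rewrite natr_sum mulr_sumr -[X in X%:R - _]card_ord -sum1_card natr_sum -sumrB.
by apply: eq_bigr => i _; case: (v i); rewrite /= ?expr1 ?expr0; ring.
Qed.

Lemma sgnprodE (k : nat) (v : boolvec k) :
  sgnprod v = (-1) ^+ (\sum_(i < k) v i)%N.
Proof. by rewrite expr_sum. Qed.

Lemma sgnprod_parity (k : nat) (v : boolvec k) :
  sgnprod v = (-1) ^+ (\big[addb/false]_(i < k) v i).
Proof.
by rewrite /sgnprod; elim/big_rec2: _ => [|i b1 y _ ->]; rewrite ?expr0 // signr_addb.
Qed.

(** This and [altmoment] are [A] and [B] of the header. *)
Definition absmoment (k : nat) (p : R) : R :=
  \sum_(v : boolvec k) `|sgnsum v - tstar R k| `^ p.
Definition altmoment (k : nat) (p : R) : R :=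
  \sum_(v : boolvec k) sgnprod v * `|sgnsum v - tstar R k| `^ p.

Lemma tstarE (k : nat) : tstar R k = (odd k)%:R.
Proof.
by rewrite /tstar -signr_odd /=; case: (odd k); rewrite /= ?expr0 ?expr1; field.
Qed.

(** The middle term [j = M] contains [0^p = 0], and the two halves agree under [j -> 2M - j]. *)
Lemma even_alternating_sum (M : nat) (p : R) : p != 0 ->
  \sum_(j < M.*2.+1) 'C(M.*2, j)%:R * ((-1) ^+ j * `|M.*2%:R - 2 * j%:R| `^ p)
  = 2 * 2 `^ p * (-1) ^+ M * altsum M p.
Proof.
move=> p0; pose G j : R := 'C(M.*2, j)%:R * ((-1) ^+ j * `|M.*2%:R - 2 * j%:R| `^ p).
rewrite -(big_mkord xpredT G) (@big_cat_nat _ _ _ M) //=; last by lia.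
rewrite [X in _ + X]big_ltn; last by lia.
have GM : G M = 0.
  by rewrite /G -mul2n natrM subrr normr0 powR0 // !mulr0.
have Gs (i : nat) : (i < M)%N -> G (M + i.+1)%N =
    2 `^ p * (-1) ^+ M * ((-1) ^+ i.+1 * 'C(M.*2, M + i.+1)%:R * i.+1%:R `^ p).
  move=> iM; rewrite /G.
  have -> : `|M.*2%:R - 2 * (M + i.+1)%:R| = 2 * i.+1%:R :> R.
    rewrite (_ : _ - _ = - (2 * i.+1%:R)); last by rewrite -mul2n; ring.
    by rewrite normrN ger0_norm.
  by rewrite powRM // exprD; ring.
have Gr (i : nat) : (i < M)%N -> G (M - i.+1)%N = G (M + i.+1)%N.
  move=> iM; rewrite /G -(bin_sub (_ : (M + i.+1 <= M.*2)%N)); last by lia.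
  rewrite (_ : M.*2 - (M + i.+1) = M - i.+1)%N; last by lia.
  congr (_ * (_ * _ `^ p)).
    rewrite -signr_odd -[RHS]signr_odd; congr (_ ^+ _).
    by rewrite oddB // oddD.
  rewrite natrB // -normrN; congr (`|_|).
  by rewrite -mul2n; ring.
rewrite GM add0r big_nat_rev /= add0n.
have -> : \sum_(M.+1 <= j < M.*2.+1) G j = \sum_(0 <= i < M) G (M + i.+1)%N.
  rewrite -{1}[M.+1]add0n big_addn (_ : M.*2.+1 - M.+1 = M)%N; last by lia.
  by apply: eq_bigr => i _; congr G; lia.
rewrite (eq_big_nat _ _ (F2 := fun i => G (M + i.+1)%N)); last first.
  by move=> i /andP[_ iM]; exact: Gr.
rewrite /altsum big_mkord -mulr2n -[LHS]mulr_natl -!mulrA; congr (_ * _).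
by rewrite mulrA mulr_sumr; apply: eq_bigr => i _; exact: Gs.
Qed.

(** Pascal's rule, with one of its two parts reversed by [j -> n - j], so that the two values of [F]
    agree in the application. *)
Lemma sum_binS (n : nat) (F : nat -> R) :
  \sum_(j < n.+2) 'C(n.+1, j)%:R * F j =
  \sum_(j < n.+1) 'C(n, j)%:R * (F (n - j)%N + F j.+1).
Proof.
under [RHS]eq_bigr do rewrite mulrDr.
rewrite big_split /= big_ord_recl /= bin0.
under eq_bigr do rewrite /bump /= add1n binS natrD mulrDl.
rewrite big_split /= addrA; congr (_ + _).
rewrite [RHS](reindex_inj rev_ord_inj) /= big_ord_recr /= bin_small // mul0r addr0.
rewrite big_ord_recl subSS subn0 subnn binn !mul1r; congr (_ + _).
apply: eq_bigr => i _; rewrite lift0 subSS.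
have := ltn_ord i => hi; rewrite -[in RHS]bin_sub; last by lia.
by rewrite (_ : n - (n - i.+1) = i.+1)%N //; lia.
Qed.

(** For odd [k], [tstar] is 1 and [k - 2j - 1 = (k + 1) - 2 (j + 1)]: by [sum_binS], the sum for the
    even number [k + 1] is -2 times the one for [k]. Hence the factor [2 - odd k]. *)
Lemma altmomentE (k : nat) (p : R) : p != 0 ->
  altmoment k p =
  2 `^ p * (-1) ^+ k./2 * (2 - (odd k)%:R) * altsum (uphalf k) p.
Proof.
move=> p0.
have -> : altmoment k p = \sum_(j < k.+1) 'C(k, j)%:R *
    ((-1) ^+ j * `|k%:R - 2 * j%:R - (odd k)%:R| `^ p).
  rewrite -(sum_boolvec_card k (fun j => (-1) ^+ j * `|k%:R - 2 * j%:R - (odd k)%:R| `^ p)).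
  by apply: eq_bigr => v _; rewrite sgnprodE sgnsumE tstarE.
have kE := odd_double_half k; rewrite uphalf_half.
case: (odd k) kE => kE; last first.
  rewrite add0n in kE; set m := k./2 in kE *; rewrite -kE add0n subr0.
  have := even_alternating_sum m p0; under [in X in _ -> X]eq_bigr do rewrite subr0.
  by move=> ->; ring.
set m := k./2 in kE *; rewrite -kE !add1n.
have := even_alternating_sum m.+1 p0; rewrite doubleS.
rewrite (sum_binS _ (fun j => (-1) ^+ j * `|m.*2.+2%:R - 2 * j%:R| `^ p)).
rewrite (eq_bigr (fun j : 'I_m.*2.+2 => -2 * ('C(m.*2.+1, j)%:R *
    ((-1) ^+ j * `|m.*2.+1%:R - 2 * j%:R - 1| `^ p)))) => [|j _]; last first.
  have jm : (j <= m.*2.+1)%N by rewrite -ltnS.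
  have -> : `|m.*2.+2%:R - 2 * (m.*2.+1 - j)%N%:R| = `|m.*2.+1%:R - 2 * j%:R - 1| :> R.
    by rewrite natrB // -normrN; congr (`|_|); ring.
  have -> : `|m.*2.+2%:R - 2 * j.+1%:R| = `|m.*2.+1%:R - 2 * j%:R - 1| :> R.
    by congr (`|_|); ring.
  have -> : (-1) ^+ (m.*2.+1 - j) = - (-1) ^+ j :> R.
    rewrite -signr_odd oddB //= odd_double /= -[in RHS]signr_odd.
    by case: (odd j); rewrite /= ?expr0 ?expr1 ?opprK.
  by rewrite exprS; ring.
rewrite -mulr_sumr exprS => h.
apply: (@mulfI _ (-2)); first by rewrite oppr_eq0.
by rewrite h (_ : true%:R = 1) //; ring.
Qed.

End SignSums.

(** * Exponential moments and positivity *)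

Section SignMatrix.
Variable R : realType.

Lemma sum_expR_sgnsum (k : nat) (mu t : R) :
  \sum_(v : boolvec k) expR (mu * (sgnsum R v - t)) =
  expR (- (mu * t)) * (expR mu + expR (- mu)) ^+ k.
Proof.
have -> : (expR mu + expR (- mu)) ^+ k = \prod_(i < k) \sum_(j : bool) expR (mu * (-1) ^+ j).
  rewrite -[X in _ ^+ X]card_ord -prodr_const; apply: eq_bigr => i _.
  by rewrite big_bool /= expr1 expr0 mulrN1 mulr1 addrC.
rewrite bigA_distr_bigA /= mulr_sumr; apply: eq_bigr => v _.
by rewrite mulrBr addrC expRD /sgnsum mulr_sumr expR_sum.
Qed.

(** [powR_le_expRD] replaces the powers by exponentials, whose sums factor over the coordinates. For
    odd [k] the shift by 1 contributes [expR lam + expR (- lam)], one more factor of the same kind,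
    so that [K = k + 1] factors occur; for even [k], [K = k]. *)
Lemma absmoment_le (k : nat) (p : R) : 0 < p -> (0 < k)%N ->
  absmoment k p <= 2 ^+ k.+1 * (p * (uphalf k).*2%:R / expR 1) `^ (p / 2).
Proof.
move=> p0 k0; set K := (uphalf k).*2.
have K0 : (0 : R) < K%:R by rewrite ltr0n double_gt0; lia.
rewrite -(moment_const p0 K0); set lam := Num.sqrt _.
have lam0 : 0 < lam by rewrite sqrtr_gt0 divr_gt0.
set c := (p / _) `^ p; set E := expR _.
have c0 : 0 <= c by exact: powR_ge0.
have coshE : expR lam + expR (- lam) <= 2 * E by apply: cosh_le_expR; exact: ltW.
apply: le_trans (_ : c * (2 * (2 * E) ^+ k * E ^+ odd k) <= _); last first.
  rewrite powR_mulrn ?expR_ge0 // le_eqVlt; apply/orP; left; apply/eqP.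
  rewrite exprMn exprS (_ : K = k + odd k)%N; last by rewrite /K; lia.
  by rewrite exprD; ring.
apply: le_trans (_ : \sum_(v : boolvec k) c *
   (expR (lam * (sgnsum R v - tstar R k)) + expR (- lam * (sgnsum R v - tstar R k))) <= _).
  by apply: ler_sum => v _; rewrite mulNr; exact: powR_le_expRD.
rewrite -mulr_sumr big_split /= ler_wpM2l // !sum_expR_sgnsum opprK tstarE.
have h0 : 0 <= expR lam + expR (- lam) by rewrite addr_ge0 ?expR_ge0.
have hk : (expR lam + expR (- lam)) ^+ k <= (2 * E) ^+ k.
  by rewrite lerXn2r ?nnegrE // mulr_ge0 ?expR_ge0.
case: (odd k); rewrite /= ?mulr1 ?mulr0 ?oppr0 ?expR0.
  have -> : expR (- lam) * (expR lam + expR (- lam)) ^+ k +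
            expR (- - lam) * (expR (- lam) + expR lam) ^+ k =
            (expR lam + expR (- lam)) * (expR lam + expR (- lam)) ^+ k.
    by rewrite opprK [expR (- lam) + _]addrC; ring.
  rewrite expr1 mulrAC; apply: ler_pM => //; exact: exprn_ge0.
rewrite [expR (- lam) + _]addrC.
lra.
Qed.

Definition bvxor (k : nat) (u v : boolvec k) : boolvec k := [ffun i => u i (+) v i].

Lemma bvxorK (k : nat) (x : boolvec k) : involutive (fun u => bvxor u x).
Proof. by move=> u; apply/ffunP => i; rewrite !ffunE addbK. Qed.

Lemma sgnprod_xor (k : nat) (u v : boolvec k) :
  sgnprod R (bvxor u v) = sgnprod R u * sgnprod R v.
Proof.
by rewrite /sgnprod -big_split; apply: eq_bigr => i _; rewrite ffunE signr_addb.
Qed.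

(** All signs -1, or all but one: the products are opposite, and the sums [-k] and [2 - k] are
    negative. Negativity keeps the sum away from [tstar]. *)
Lemma exists_sgnprod (k : nat) (s : bool) : (3 <= k)%N ->
  exists2 v : boolvec k, sgnprod R v = (-1) ^+ s & sgnsum R v < 0.
Proof.
move=> k3; have k0 : (0 < k)%N by lia.
have k3R : (3 : R) <= k%:R by rewrite ler_nat.
have w0 : (\sum_(i < k) ([ffun=> true] : boolvec k) i = k)%N.
  by under eq_bigr do rewrite ffunE; rewrite sum1_card card_ord.
pose i0 := Ordinal k0.
have w1 : (\sum_(i < k) ([ffun i => i != i0] : boolvec k) i = k.-1)%N.
  rewrite (bigD1 i0) //= ffunE eqxx add0n (eq_bigr (fun=> 1%N)); last first.
    by move=> i i0n; rewrite ffunE i0n.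
  by rewrite sum1_card cardC1 card_ord.
have [ok|ok] := eqVneq (odd k) s.
  exists [ffun=> true]; first by rewrite sgnprodE w0 -signr_odd ok.
  by rewrite sgnsumE w0; lra.
exists [ffun i => i != i0].
  by rewrite sgnprodE w1 -signr_odd; congr (_ ^+ (_ : bool)); move: ok; lia.
by rewrite sgnsumE w1 -subn1 natrB //; lra.
Qed.

(** Termwise, the weights 1 and [(-1)^s sgnprod v] add up to 0 or 2, and the vector of
    [exists_sgnprod] gives a positive term. *)
Lemma moment_gt0 (k : nat) (p : R) (s : bool) : (3 <= k)%N ->
  0 < absmoment k p + (-1) ^+ s * altmoment k p.
Proof.
move=> k3; have [v0 hv0 sv0] := exists_sgnprod s k3.
rewrite /absmoment /altmoment mulr_sumr -big_split /= (bigD1 v0) //=.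
rewrite ltr_pwDl //.
  rewrite hv0 mulrA -expr2 sqrr_sign mul1r addr_gt0 ?powR_gt0 ?normr_gt0 //;
  by rewrite lt_eqF // subr_lt0 tstarE (lt_le_trans sv0).
apply: sumr_ge0 => v _; rewrite mulrA -{1}[_ `^ _]mul1r -mulrDl mulr_ge0 ?powR_ge0 //.
rewrite sgnprod_parity -signr_addb; case: (_ (+) _); rewrite ?expr0 ?expr1; lra.
Qed.

Lemma sign_colE (k : nat) (u : boolvec k) (i : 'I_k) :
  sign_col R u i 0 = (-1) ^+ u i.
Proof. by rewrite !mxE; case: (u i); rewrite /= ?mulr0 ?mulr1 ?expr0 ?expr1; ring. Qed.

(** * Norms and rank of the sign matrix *)

Section Rows.
Variables (p : R) (k n : nat) (b : bool).
Hypothesis (p1 : 1 <= p) (hn : Num.floor (p / 2) = n%:Z).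
Let s : bool := odd (k./2 + n) (+) b.

Lemma alphaE (u : boolvec k) :
  alpha p b (sign_col R u) = 1 + (-1) ^+ s * sgnprod R u.
Proof.
rewrite /alpha /eta_exp hn divn2 -!PoszD; congr (1 + _ * _).
  by rewrite -exprnP -[LHS]signr_odd oddD oddb.
by apply: eq_bigr => i _; rewrite sign_colE.
Qed.

Lemma alpha_bool (u : boolvec k) :
  alpha p b (sign_col R u) = (2 * (sgnprod R u == (-1) ^+ s))%:R.
Proof.
rewrite alphaE sgnprod_parity; case: s; case: (\big[_/_]_(_ < _) _);
  rewrite /= ?expr0 ?expr1 ?eqxx ?muln1 ?mulrNN ?mulr1 ?mul1r //.
- by rewrite (_ : (1 == -1 :> R) = false) ?muln0 ?subrr //; apply/eqP; lra.
- by rewrite (_ : (-1 == 1 :> R) = false) ?muln0 ?subrr //; apply/eqP; lra.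
Qed.

(** Row [u] is [alpha^(1/p)] times the inner product of [u] and [y], minus [tstar]. Replacing [u] by
    the entrywise product of [u] and [y] turns the inner product into a sum of signs and multiplies
    the product of signs by that of [y]. *)
Lemma lpnorm_signE (x : boolvec k) :
  lpnorm p (Wmx p k b *m sign_col R x - wvec p k b) `^ p =
  absmoment k p + (-1) ^+ s * sgnprod R x * altmoment k p.
Proof.
have p0 : p != 0 by exact: lt0r_neq0 (lt_le_trans ltr01 p1).
rewrite /lpnorm -powRrM mulVf // powRr1; last by apply: sumr_ge0 => i _; exact: powR_ge0.
pose F (u : boolvec k) : R := alpha p b (sign_col R u) *
  `|\sum_(i < k) (-1) ^+ u i * (-1) ^+ x i - tstar R k| `^ p.
have a0 (u : boolvec k) : 0 <= alpha p b (sign_col R u) by rewrite alpha_bool.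
transitivity (\sum_(u : boolvec k) F u).
  rewrite (reindex (@enum_val _ (mem {: boolvec k}))) /=; last first.
    by apply: onW_bij; exact: enum_val_bij.
  apply: eq_bigr => i _; rewrite !mxE /F /row_sign.
  set al := alpha _ _ _.
  rewrite (eq_bigr (fun j => al `^ p^-1 * ((-1) ^+ (enum_val i) j * (-1) ^+ x j))); last first.
    by move=> j _; rewrite mxE sign_colE /row_sign sign_colE mulrA.
  rewrite -mulr_sumr -mulrBr normrM powRM // (ger0_norm (powR_ge0 _ _)) -powRrM mulVf //.
  by rewrite powRr1 ?a0.
rewrite (reindex_inj (inv_inj (@bvxorK k x))) /= /F.
rewrite /absmoment /altmoment mulr_sumr -big_split /=.
apply: eq_bigr => v _; rewrite alphaE sgnprod_xor.
have -> : \sum_(i < k) (-1) ^+ (bvxor v x) i * (-1) ^+ x i = sgnsum R v.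
  by apply: eq_bigr => i _; rewrite ffunE -signr_addb addbK.
by ring.
Qed.

Lemma rank_Wmx : (3 <= k)%N -> \rank (Wmx p k b) = k.
Proof.
move=> k3; rewrite -mxrank_tr; apply/eqP; apply: inj_row_free => z zW.
have hz (u : boolvec k) : sgnprod R u = (-1) ^+ s -> \sum_(j < k) z 0 j * (-1) ^+ u j = 0.
  move=> hu; have /rowP /(_ (enum_rank u)) := zW; rewrite !mxE.
  rewrite (eq_bigr (fun j => 2 `^ p^-1 * (z 0 j * (-1) ^+ u j))) => [|j _]; last first.
    rewrite mxE mxE /row_sign enum_rankK alpha_bool hu eqxx muln1 sign_colE; ring.
  by rewrite -mulr_sumr => /eqP; rewrite mulf_eq0 gt_eqF ?powR_gt0 // => /eqP.
have [u hu _] := exists_sgnprod s k3.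
(* Flipping two signs preserves the product, hence stays among the nonzero rows. *)
have pair (i j : 'I_k) : i != j -> z 0 i * (-1) ^+ u i + z 0 j * (-1) ^+ u j = 0.
  move=> ij; pose f : boolvec k := [ffun l => (l == i) || (l == j)].
  have hf : sgnprod R f = 1.
    rewrite /sgnprod (bigD1 i) //= (bigD1 j) ?[j == i]eq_sym //= big1 => [|l /andP[li lj]].
      by rewrite !ffunE !eqxx orbT mulr1 -expr2 sqrr_sign.
    by rewrite ffunE (negbTE li) (negbTE lj).
  have h1 := hz _ hu.
  have h2 : \sum_(j < k) z 0 j * (-1) ^+ (bvxor u f) j = 0.
    by apply: hz; rewrite sgnprod_xor hf mulr1.
  have : \sum_(l < k) (z 0 l * (-1) ^+ u l - z 0 l * (-1) ^+ (bvxor u f) l) = 0.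
    by rewrite sumrB h1 h2 subrr.
  rewrite (bigD1 i) //= (bigD1 j) ?[j == i]eq_sym //= big1 => [|l /andP[li lj]]; last first.
    by rewrite !ffunE (negbTE li) (negbTE lj) addbF subrr.
  rewrite !ffunE !eqxx orbT !addbT !signrN; lra.
apply/rowP => i; rewrite mxE.
(* For three distinct indices, the relations [x + y = x + z = y + z = 0] force [x = 0]. *)
have [j [l [ij il jl]]] : exists j l : 'I_k, [/\ i != j, i != l & j != l].
  pose o (m : nat) (h : (m < 3)%N) : 'I_k := Ordinal (leq_trans h k3).
  case: (boolP (i == o 0%N isT)) => [/eqP ->|i0].
    by exists (o 1%N isT), (o 2 isT).
  case: (boolP (i == o 1%N isT)) => [/eqP ->|i1].
    by exists (o 0%N isT), (o 2 isT).
  by exists (o 0%N isT), (o 1%N isT).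
have := pair i j ij; have := pair i l il; have := pair j l jl => e1 e2 e3.
have : z 0 i * (-1) ^+ u i = 0 by lra.
by move/eqP; rewrite mulf_eq0 signr_eq0 orbF => /eqP.
Qed.

End Rows.
End SignMatrix.

(** * The parallelepiped *)

Lemma sgnsum_int (R : realType) (k : nat) (v : boolvec k) :
  sgnsum R v - tstar R k =
  (k%:Z - 2 * (\sum_(i < k) v i)%N%:Z - (odd k)%:Z)%:~R.
Proof. by rewrite sgnsumE tstarE !rmorphB /= rmorphM /=. Qed.

Lemma approximable_natX (R : realType) (phi : nat -> nat) (m : nat) (p : R) :
  p != 0 -> approximable phi p -> approximable phi (m%:R `^ p).
Proof.
move=> p0 hp; case: m => [|m]; first by rewrite powR0 //; exact: (approximable_nat _ _ 0).
by apply: approximable_powR => //; exact: approximable_nat.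
Qed.

(** The two moments combine termwise into a sum of terms 0 or [2 m^p] with natural [m], so no
    subtraction is left. *)
Lemma approximable_moment (R : realType) (phi : nat -> nat) (k : nat) (p : R)
    (s : bool) : p != 0 -> approximable phi p ->
  approximable phi (absmoment k p + (-1) ^+ s * altmoment k p).
Proof.
move=> p0 hp; rewrite /absmoment /altmoment mulr_sumr -big_split /=.
apply: approximable_sum => v.
set x := `|sgnsum R v - tstar R k|.
have -> : x `^ p + (-1) ^+ s * (sgnprod R v * x `^ p) =
    (2 * (~~ (s (+) \big[addb/false]_(i < k) v i)))%N%:R * x `^ p.
  rewrite sgnprod_parity mulrA -signr_addb -{1}[_ `^ _]mul1r -mulrDl; congr (_ * _).
  by case: (_ (+) _); rewrite /= ?expr0 ?expr1 ?subrr.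
apply: approximable_natM; rewrite /x sgnsum_int -intr_norm -abszE.
exact: approximable_natX.
Qed.

(** For the ratio [r], [r^(1/p) - 1 >= ln r / p], and [ln r >= 1 - 1 / r = 2 b / (A + b) >= b /
    A]. *)
Lemma ratio_root_ge (R : realType) (A b p : R) : 0 < p -> 0 <= b -> b < A ->
  b / (p * A) <= ((A + b) / (A - b)) `^ p^-1 - 1.
Proof.
move=> p0 b0 bA.
have A0 : 0 < A by lra.
have h1 : 0 < A - b by lra.
have h2 : 0 < A + b by lra.
have r0 : 0 < (A + b) / (A - b) by rewrite divr_gt0.
have hl : b / A <= ln ((A + b) / (A - b)).
  have := ln_le_sub1 (divr_gt0 h1 h2); rewrite !ln_div ?posrE // => h.
  have : b / A <= 1 - (A - b) / (A + b).
    have -> : 1 - (A - b) / (A + b) = 2 * b / (A + b) by field; rewrite gt_eqF.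
    rewrite ler_pdivrMr // mulrAC ler_pdivlMr // -subr_ge0.
    have -> : 2 * b * A - b * (A + b) = b * (A - b) by ring.
    by rewrite mulr_ge0 // ltW.
  lra.
rewrite /powR gt_eqF // lerBrDl.
apply: le_trans (expR_ge1Dx _); rewrite lerD2l invfM mulrCA ler_pM2l ?invr_gt0 //.
Qed.

Lemma central_binomial_ge (R : realType) (M : nat) : (0 < M)%N ->
  4 ^+ M / (2 * Num.sqrt M%:R) <= 'C(M.*2, M)%:R :> R.
Proof.
move=> M0; have s0 : 0 < Num.sqrt M%:R :> R by rewrite sqrtr_gt0 ltr0n.
rewrite ler_pdivrMr ?mulr_gt0 //.
rewrite -(@ler_pXn2r _ 2) ?nnegrE ?exprn_ge0 ?mulr_ge0 ?sqrtr_ge0 //.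
rewrite !exprMn sqr_sqrtr ?ler0n //.
have := central_binomial_sqr_ge M0; rewrite -(ler_nat R) !natrM !natrX.
by rewrite expr2 => /le_trans; apply; rewrite le_eqVlt; apply/orP; left; apply/eqP; ring.
Qed.

Lemma lpnormZ (R : realType) (p c : R) (d : nat) (x : 'cV[R]_d) :
  p != 0 -> 0 <= c -> lpnorm p (c *: x) = c * lpnorm p x.
Proof.
move=> p0 c0; rewrite /lpnorm.
rewrite (eq_bigr (fun i => c `^ p * `|x i 0| `^ p)) => [|i _]; last first.
  by rewrite mxE normrM powRM // ger0_norm.
rewrite -mulr_sumr powRM ?powR_ge0 //; last by apply: sumr_ge0 => i _; exact: powR_ge0.
by rewrite -powRrM divff // powRr1.
Qed.

Lemma lpnormK (R : realType) (p : R) (d : nat) (x : 'cV[R]_d) :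
  p != 0 -> lpnorm p x = (lpnorm p x `^ p) `^ p^-1.
Proof. by move=> p0; rewrite -powRrM divff // powRr1 // powR_ge0. Qed.

Lemma double_uphalf (k : nat) : ((uphalf k).*2 = k + odd k)%N.
Proof. by lia. Qed.

Lemma int_sign_entry (R : realType) (c x : R) (e : bool) :
  c * (-2 * (x * (-1) ^+ e)) = (if e then 2%:Z else - 2%:Z)%:~R * (c * x).
Proof. by case: e; rewrite ?mulrNz /= ?expr0 ?expr1 -pmulrn; ring. Qed.

Lemma int_shift_entry (R : realType) (c x t s : R) (z : int) :
  s - t = z%:~R -> c * (x * t - x * s) = (- z)%:~R * (c * x).
Proof. by rewrite mulrNz => <-; ring. Qed.

Theorem theorem4p5 (R : realType) (k : nat) (p : R) (b : bool)
    (hk : (3 <= k)%N) (hp1 : 1 <= p) (hpk : p < k%:R) :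
  exists (eps : R) (V : 'M[R]_(nsigns k, k)) (t : 'cV[R]_(nsigns k)),
    [/\ `|sin (pi * p / 2)| / p ^+ 2
          * (2 * p / (expR 1 ^+ 2 * pi ^+ 2 * k%:R)) `^ ((p + 1) / 2) <= eps,
        isolating_parallelepiped p (@parity_constraint b k) eps V t,
        computable_parallelepiped p V t,
        exists c : R,
          [/\ 0 < c,
              V = c *: ((-2) *: Wmx p k b)
            & t = c *: (wvec p k b - Wmx p k b *m const_mx 1)]
      & exists a : R, forall x : boolvec k,
          lpnorm p (Wmx p k b *m sign_col R x - wvec p k b) `^ p =
            if parity_constraint b x then a else a * (1 + eps) `^ p].
Proof.
have p0 : 0 < p by lra.
have pn0 : p != 0 by rewrite gt_eqF.
have pi0 := pi_gt0 R.
have k0 : (0 : R) < k%:R by rewrite ltr0n (leq_trans _ hk).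
have [n hn] : exists n : nat, Num.floor (p / 2) = n%:Z.
  by exists `|Num.floor (p / 2)|%N; rewrite gez0_abs // floor_ge0; lra.
have n1 : n%:R <= p / 2 by have := floor_le (p / 2); rewrite hn.
have n2 : p / 2 < n%:R + 1 by have := floorD1_gt (p / 2); rewrite hn intrD.
pose M := uphalf k; pose tau : R := 2 - (odd k)%:R.
have ME : (M.*2 = k + odd k)%N by exact: double_uphalf.
have M0 : (0 < M)%N by rewrite -double_gt0 ME addn_gt0 (leq_trans _ hk).
have tau0 : 0 < tau by rewrite /tau; case: (odd k) => /=; lra.
pose A : R := absmoment k p.
have hT := @altsum_bound R M n p hp1.
have {}hT : `|sin (pi * p / 2)| / (2 * pi * p) * 'C(M.*2, M)%:R *
    (p / (expR 1 * pi)) `^ p <= (-1) ^+ n.+1 * altsum M p.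
  apply: hT => //; apply: lt_le_trans hpk _; by rewrite ler_nat ME leq_addr.
pose beta : R := 2 `^ p * tau * ((-1) ^+ n.+1 * altsum M p).
have Z0 : 0 <= (p / (expR 1 * pi)) `^ p by exact: powR_ge0.
have beta0 : 0 <= beta.
  apply: mulr_ge0; first by rewrite mulr_ge0 ?powR_ge0 // ltW.
  by apply: le_trans hT; rewrite !mulr_ge0 ?invr_ge0 ?mulr_ge0 // ltW.
pose sg := odd (k./2 + n).
(* Here the choice of [eta_exp] enters: the alternating moment vanishes or has the sign opposite to
   [(-1)^eta], so that the value on the inputs satisfying the constraint is the smaller one,
   [A - beta]. *)
have betaE : (-1) ^+ sg * altmoment k p = - beta.
  rewrite altmomentE // /beta /sg signr_odd exprD exprS -/M -/tau.
  have s2 : (-1) ^+ k./2 * (-1) ^+ k./2 = 1 :> R by rewrite -expr2 sqrr_sign.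
  transitivity (((-1) ^+ k./2 * (-1) ^+ k./2) * ((-1) ^+ n * (2 `^ p * tau * altsum M p))).
    by ring.
  by rewrite s2; ring.
pose a : R := A - beta.
have a0 : 0 < a by rewrite /a -betaE; exact: moment_gt0.
have betaA : beta < A by rewrite -subr_gt0.
pose r : R := (A + beta) / a.
have r0 : 0 < r by rewrite divr_gt0 //; lra.
(* Forced by [a (1 + eps)^p = A + beta]. *)
pose eps : R := r `^ p^-1 - 1.
have eps_ge : beta / (p * A) <= eps by exact: ratio_root_ge.
have A0 : 0 < A by lra.
have eps0 : 0 <= eps by apply: le_trans eps_ge; rewrite divr_ge0 // ltW // mulr_gt0.
have epsX : (1 + eps) `^ p = r by rewrite subrKC -powRrM mulVf // powRr1 // ltW.
have ar : a * r = A + beta by rewrite mulrCA divff ?mulr1 // gt_eqF.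
have normE (x : boolvec k) : lpnorm p (Wmx p k b *m sign_col R x - wvec p k b) `^ p =
    if parity_constraint b x then a else a * (1 + eps) `^ p.
  rewrite (lpnorm_signE b hp1 hn) sgnprod_parity /parity_constraint.
  set par := \big[addb/false]_(i < k) x i.
  have -> : (-1) ^+ (sg (+) b) * (-1) ^+ par * altmoment k p =
     (-1) ^+ (b (+) par) * - beta.
    by rewrite -betaE !signr_addb; ring.
  rewrite epsX ar; case: b; case: par; rewrite /= ?expr0 ?expr1 /a /A; ring.
(* Scaling by [c] makes the smaller of the two norms equal to 1. *)
pose c : R := (a `^ p^-1)^-1.
have c0 : 0 < c by rewrite invr_gt0 powR_gt0.
pose V := c *: ((-2) *: Wmx p k b).
pose t := c *: (wvec p k b - Wmx p k b *m const_mx 1).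
exists eps, V, t; split.
- apply: le_trans eps_ge.
  set Y := (_ `^ ((p + 1) / 2)); set sn := `|sin _| in hT *.
  have Y0 : 0 <= Y by exact: powR_ge0.
  have hA := absmoment_le p0 (leq_trans (isT : (0 < 3)%N) hk).
  have MR : (0 : R) < M%:R by rewrite ltr0n.
  have KE : M.*2%:R = 2 * M%:R :> R by rewrite -mul2n natrM.
  (* As [2M = k + odd k], this amounts to [3 <= k] when [k] is odd. *)
  have hK : 3 * M.*2%:R <= 4 * k%:R :> R.
    rewrite -!natrM ler_nat ME mulnDr [(4 * k)%N]mulSn addnC leq_add2r.
    by case: (odd k); rewrite ?muln0 // muln1.
  have hY := bound_comparison hp1 k0 hK MR KE; rewrite -/Y -/M in hY hA.
  have hC := central_binomial_ge R M0.
  (* The parity factor and the [4^M] of the central binomial coefficient match the [2^(k+1)] in the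
     bound for [A], whatever the parity of [k]. *)
  have tau2 : tau * 4 ^+ M = 2 ^+ k.+1.
    rewrite (_ : 4 = 2 ^+ 2); last by ring.
    rewrite -exprM mul2n /tau.
    rewrite ME.
    by case: (odd k) => /=; rewrite ?addn1 ?addn0 ?exprS; ring.
  set Z := (p / (expR 1 * pi)) `^ p in hT hY Z0.
  have sq0 : 0 < Num.sqrt M%:R :> R by rewrite sqrtr_gt0.
  have hb : 2 `^ p * tau * (sn / (2 * pi * p) * (4 ^+ M / (2 * Num.sqrt M%:R)) * Z) <= beta.
    rewrite /beta ler_wpM2l ?mulr_ge0 ?powR_ge0 ?(ltW tau0) //.
    apply: le_trans hT; rewrite ler_wpM2r // ler_wpM2l // divr_ge0 ?normr_ge0 //.
    by rewrite !mulr_ge0 // ltW.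
  have hY2 : A * Y <= 2 ^+ k.+1 * (2 `^ p / (4 * pi * Num.sqrt M%:R) * Z).
    apply: le_trans (_ : 2 ^+ k.+1 * ((p * M.*2%:R / expR 1) `^ (p / 2) * Y) <= _).
      by rewrite mulrA ler_wpM2r.
    by rewrite ler_wpM2l ?exprn_ge0.
  rewrite ler_pdivlMr ?mulr_gt0 //.
  have -> : sn / p ^+ 2 * Y * (p * A) = sn / p * (A * Y) by field.
  apply: le_trans (_ : sn / p * (2 ^+ k.+1 * (2 `^ p / (4 * pi * Num.sqrt M%:R) * Z)) <= _).
    by rewrite ler_wpM2l // divr_ge0 ?normr_ge0 // ltW.
  apply: le_trans hb; rewrite -tau2 le_eqVlt; apply/orP; left; apply/eqP.
  move: (@pi R) (lt0r_neq0 pi0) (Z) (sn) => x x0 z s.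
  by field; rewrite x0 pn0 gt_eqF.
- have VE (x : boolvec k) : V *m bit_col R x - t =
      c *: (Wmx p k b *m sign_col R x - wvec p k b).
    rewrite /V /t -scalemxAl -scalerBr; congr (_ *: _).
    rewrite /sign_col mulmxBr -scalemxAr -scalemxAl scaleNr opprB.
    by rewrite addrCA addrA.
  have cz (z : R) : 0 <= z -> c * (a * z `^ p) `^ p^-1 = z.
    move=> z0; rewrite powRM ?powR_ge0 ?(ltW a0) // mulrA mulVf ?mul1r; last first.
      by rewrite gt_eqF ?powR_gt0.
    by rewrite -powRrM divff // powRr1.
  split=> //.
  + rewrite /V !mxrank_scale_nz ?oppr_eq0 ?gt_eqF //.
    exact: (rank_Wmx b hn hk).
  + move=> x hx; rewrite VE lpnormZ ?(ltW c0) // lpnormK // normE hx.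
    by have := cz 1 ler01; rewrite powR1 mulr1.
  + move=> x hx; rewrite VE lpnormZ ?(ltW c0) // lpnormK // normE hx.
    by apply: cz; rewrite addr_ge0.
- have rowc (i : 'I_(nsigns k)) (phi : nat -> nat) : dyadic_name p phi ->
      approximable phi (c * alpha p b (row_sign R i) `^ p^-1).
    move=> /approximable_name hp; rewrite /row_sign (alpha_bool b hn).
    set N := (2 * _)%N.
    (* [N] is 0 or 2: vanishing rows have entries 0, and the others are integer multiples of
       [(N / a)^(1/p)], a power of a positive approximable real. *)
    case: N => [|N].
      by rewrite powR0 ?invr_eq0 // mulr0; exact: (approximable_nat _ _ 0).
    have -> : c * N.+1%:R `^ p^-1 = (N.+1%:R * a^-1) `^ p^-1.
      rewrite powRM ?invr_ge0 ?(ltW a0) // mulrC; congr (_ * _).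
      by rewrite -(powR_inv1 (ltW a0)) -powRrM mulN1r powRN.
    apply: approximable_powR; first by rewrite mulr_gt0 ?invr_gt0.
      apply: approximable_natM; apply: approximable_inv => //.
      by rewrite /a -betaE; exact: approximable_moment.
    by apply: approximable_inv.
  split=> [i j|i].
    rewrite mxE mxE [Wmx _ _ _ _ _]mxE [row_sign R i j 0]sign_colE int_sign_entry.
    by apply: computable_from_intM; exact: rowc.
  rewrite mxE mxE [wvec _ _ _ _ _]mxE mxE [(_ *m _) _ _]mxE.
  rewrite (eq_bigr (fun j => alpha p b (row_sign R i) `^ p^-1 *
      (-1) ^+ (enum_val i) j)) => [|j _]; last first.
    by rewrite [const_mx _ _ _]mxE mulr1 [Wmx _ _ _ _ _]mxE [row_sign R i j 0]sign_colE.
  rewrite -mulr_sumr (int_shift_entry _ _ (sgnsum_int R (enum_val i))).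
  by apply: computable_from_intM; exact: rowc.
- by exists c.
- by exists a.
Qed.
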